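(* Let $F$ be a field, $D\in F$ with $D\ne0,1$, $d=D-1$, $\tau=d^{-2}$, let $n\ge 2$ and suppose $D$ is $n$-generic, i.e. $P_k(\tau)\ne 0$ for $1\le k\le n$. Then for all $2\le k\le n$: 1. $g_kl_i=g_kr_i=g_ke_i=l_ig_k=r_ig_k=e_ig_k=0$ for $1\le i\le k-1$; 2. $g_k=g_k^*=g_k^2$; 3. $E(g_k)=\frac{d\,P_k(\tau)}{D\,P_{k-1}(\tau)}\,g_{k-1}$; 4. $g_ig_j=g_j$ if $1\le i\le j\le n$; 5. $g_k=1+\sum_i c_iw_i$ (a finite sum), where $c_i\in F$ and each $w_i\ne1$ is a word in $\{l_j,r_j,e_j\mid 1\le j\le k-1\}$.
   Context: A Motzkin $n$-diagram is a noncrossing partial matching (up to isotopy) of $n$ top points and $n$ bottom points of a rectangle by strings inside the rectangle: each point is joined to at most one other point. $M_n(D)$ is the $F$-vector space with basis the Motzkin $n$-diagrams and product $xy=D^{\kappa(x,y)}z$, where $x$ is stacked above $y$, the bottom points of $x$ are identified with the top points of $y$, $z$ is the resulting diagram on the outer points, and $\kappa(x,y)$ is the number of closed loops formed (non-closed strings not reaching the outer points are discarded with factor $1$). $M_n(D)\subset M_{n+1}(D)$ by adding a vertical string on the right. The adjoint $*$ reflects diagrams top to bottom and is extended $\sigma$-linearly for an involution $\sigma$ of $F$ fixing $D$ (possibly trivial). $p_i$: top point $i$ and bottom point $i$ isolated, other strings vertical. $l_i$: top point $i$ joined to bottom point $i+1$, top point $i+1$ and bottom point $i$ isolated, other strings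 vertical; $r_i=l_i^*$. $e_i$: $D^{-1}$ times the diagram in which top points $i,i+1$ are joined, bottom points $i,i+1$ are joined, and other strings are vertical. $E:M_k(D)\to M_{k-1}(D)$ is $D^{-1}$ times the map closing up the last string (joining the $k$-th top point to the $k$-th bottom point outside on the right, closed loops replaced by $D$). $P_0(x)=P_1(x)=1$, $P_{k+1}(x)=P_k(x)-xP_{k-1}(x)$. The elements $g_k\in M_k(D)$ are defined by $g_1=1-p_1$ and $g_{k+1}=g_k(1-p_{k+1})-\frac{D}{d}\frac{P_{k-1}(\tau)}{P_k(\tau)}\,g_ke_kg_k$ for $1\le k\le n-1$. *)

(* Defs.v *)
From HB Require Import structures.
From mathcomp Require Import all_boot all_order all_algebra.

Set Implicit Arguments.
Unset Strict Implicit.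
Unset Printing Implicit Defensive.

Import GRing.Theory.
Local Open Scope ring_scope.

(* Boundary points of the rectangle: [inl i] is the (i+1)-st top point and    *)
(* [inr i] the (i+1)-st bottom point.                                         *)
Definition point (n : nat) : finType := ('I_n + 'I_n)%type.

(* A set of strings, as the set of ordered pairs of points that are joined.   *)
Notation strings n := {set point n * point n}.

(* Clockwise position on the boundary, starting at the top left corner.       *)
Definition position n (u : point n) : nat :=
  match u with inl i => i | inr i => (n + rev_ord i)%N end.

(* Two strings cross iff their endpoints alternate around the boundary.       *)
Definition is_motzkin n (E : strings n) : bool :=
  [&& [forall u, (u, u) \notin E],
      [forall u, forall v, ((u, v) \in E) ==> ((v, u) \in E)],
      [forall u, forall v, forall w,
         ((u, v) \in E) && ((u, w) \in E) ==> (v == w)]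
    & [forall u, forall v, forall w, forall z,
         ((u, v) \in E) && ((w, z) \in E) ==>
         ~~ [&& position u < position w, position w < position v
              & position v < position z]%N]].

Definition motzkin (n : nat) := {E : strings n | is_motzkin E}.

(* [diag n tt bb tb] joins top points i, j when [tt i j], bottom points i, j  *)
(* when [bb i j], and top point i to bottom point j when [tb i j], with       *)
(* points numbered from 1 to n.                                               *)
Definition diag n (tt bb tb : rel nat) : strings n :=
  [set uv : point n * point n |
     match uv with
     | (inl i, inl j) => tt i.+1 j.+1
     | (inr i, inr j) => bb i.+1 j.+1
     | (inl i, inr j) => tb i.+1 j.+1
     | (inr j, inl i) => tb i.+1 j.+1
     end].

Definition nostring : rel nat := fun _ _ => false.

Definition map_strings m n (f : point m -> point n) (E : strings m) :
  strings n := [set (f uv.1, f uv.2) | uv in E].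

(* ** Stacking *)

(* Vertices of the picture of x stacked above y: [inl u] is the outer point u *)
(* and [inr i] the point at which bottom point i of x meets top point i of y. *)
Definition vertex (n : nat) : finType := (point n + 'I_n)%type.

Definition in_upper n (u : point n) : vertex n :=
  match u with inl i => inl (inl i) | inr i => inr i end.
Definition in_lower n (u : point n) : vertex n :=
  match u with inl i => inr i | inr i => inl (inr i) end.

Definition upper_edge n (E : strings n) : rel (vertex n) :=
  fun p q => [exists uv in E, (p == in_upper uv.1) && (q == in_upper uv.2)].
Definition lower_edge n (E : strings n) : rel (vertex n) :=
  fun p q => [exists uv in E, (p == in_lower uv.1) && (q == in_lower uv.2)].

Definition stack_edge n (x y : strings n) : rel (vertex n) :=
  fun p q => upper_edge x p q || lower_edge y p q.

Definition stack n (x y : strings n) : strings n :=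
  [set uv | (uv.1 != uv.2) &&
            connect (stack_edge x y) (inl uv.1) (inl uv.2)].

(* A connected component is a closed loop iff a string of x and a string of y *)
(* meet at each of its vertices; in particular it has no outer point.         *)
Definition on_loop n (x y : strings n) (p : vertex n) : bool :=
  [forall q, connect (stack_edge x y) p q ==>
     [exists s, upper_edge x q s] && [exists s, lower_edge y q s]].

Definition kappa n (x y : strings n) : nat :=
  n_comp (stack_edge x y) (on_loop x y).

(* ** The other operations on diagrams *)

Definition reflect_strings n (E : strings n) : strings n :=
  map_strings
    (fun u : point n => match u with inl i => inr i | inr i => inl i end) E.

Definition widen_point m n (le_mn : (m <= n)%N) (u : point m) : point n :=
  match u with
  | inl i => inl (widen_ord le_mn i)
  | inr i => inr (widen_ord le_mn i)
  end.

(* Adds n - m vertical strings on the right.                                  *)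
Definition pad m n (le_mn : (m <= n)%N) (E : strings m) : strings n :=
  map_strings (widen_point le_mn) E :|:
  diag n nostring nostring (fun i j => (i == j) && (m < i)%N).

(* The string joining the last top point to the last bottom point.            *)
Definition last_string k : strings k :=
  diag k nostring nostring (fun i j => (i == k) && (j == k)).

Definition close_last k (E : strings k) : strings k.-1 :=
  [set uv | (uv.1 != uv.2) &&
            connect (fun p q => (p, q) \in E :|: last_string k)
                    (widen_point (leq_pred k) uv.1)
                    (widen_point (leq_pred k) uv.2)].

(* Closing up creates a loop exactly when the last top and bottom points are  *)
(* already joined to each other.                                              *)
Definition close_loops k (E : strings k) : nat := last_string k \subset E.

(* ** The algebra M_n(D) *)

(* The parameter [D] does not affect the vector space; it is carried by the   *)
(* type so that the product can find it.                                      *)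
Definition motzkin_alg (F : fieldType) (D : F) (n : nat) : Type :=
  {ffun motzkin n -> F^o}.

HB.instance Definition _ (F : fieldType) (D : F) (n : nat) :=
  GRing.Lmodule.copy (motzkin_alg D n) {ffun motzkin n -> F^o}.

Section Algebra.

Variables (F : fieldType) (D : F).
Local Notation M := (motzkin_alg D).

Definition coef n (x : M n) (a : motzkin n) : F :=
  (x : {ffun motzkin n -> F^o}) a.

(* The basis vector of a Motzkin diagram given by its strings. Every set it is *)
(* applied to below is a Motzkin diagram (it would be sent to 0 otherwise); in *)
(* particular stacking and closing up preserve planarity.                     *)
Definition basis n (E : strings n) : M n :=
  [ffun a : motzkin n => (val a == E)%:R : F^o].

Definition mone n : M n := basis (diag n nostring nostring eq_op).

Definition mmul n (x y : M n) : M n :=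
  \sum_(a : motzkin n) \sum_(b : motzkin n)
    (coef x a * coef y b * D ^+ kappa (val a) (val b)) *:
      basis (stack (val a) (val b)).

Definition minc m n (le_mn : (m <= n)%N) (x : M m) : M n :=
  \sum_(a : motzkin m) coef x a *: basis (pad le_mn (val a)).

Definition madj (sigma : F -> F) n (x : M n) : M n :=
  \sum_(a : motzkin n) sigma (coef x a) *: basis (reflect_strings (val a)).

(* E : M_k(D) -> M_{k-1}(D), meaningful for k > 0.                            *)
Definition mE k (x : M k) : M k.-1 :=
  D^-1 *: \sum_(a : motzkin k)
            (coef x a * D ^+ close_loops (val a)) *:
              basis (close_last (val a)).

(* Generators of M_n(D), indexed from 1 as in p_1, ..., p_n.                  *)
Definition mp n (i : nat) : M n :=
  basis (diag n nostring nostring (fun s t => (s == t) && (s != i))).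

Definition vertical_off (i : nat) : rel nat :=
  fun s t => [&& s == t, s != i & s != i.+1].

Definition l_strings n (i : nat) : strings n :=
  diag n nostring nostring
    (fun s t => (s == i) && (t == i.+1) || vertical_off i s t).

Definition ml n (i : nat) : M n := basis (l_strings n i).
Definition mr n (i : nat) : M n := basis (reflect_strings (l_strings n i)).

Definition cap (i : nat) : rel nat :=
  fun s t => (s == i) && (t == i.+1) || (s == i.+1) && (t == i).

Definition me n (i : nat) : M n :=
  D^-1 *: basis (diag n (cap i) (cap i) (vertical_off i)).

Fixpoint mP (k : nat) : {poly F} :=
  if k is k1.+1 then
    if k1 is k2.+1 then mP k1 - 'X * mP k2 else 1
  else 1.

Definition md : F := D - 1.
Definition mtau : F := md ^- 2.

Definition generic (n : nat) : Prop :=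
  forall k, (1 <= k <= n)%N -> (mP k).[mtau] != 0.

(* The value at k = 0 is a convention: the sequence starts at k = 1.          *)
Fixpoint mg (k : nat) : M k :=
  match k with
  | 0 => mone 0
  | k1.+1 =>
    if k1 == 0 then mone k1.+1 - mp k1.+1 1
    else
      let gk := minc (leqnSn k1) (mg k1) in
      mmul gk (mone k1.+1 - mp k1.+1 k1.+1)
      - (D / md * ((mP k1.-1).[mtau] / (mP k1).[mtau])) *:
          mmul (mmul gk (me k1.+1 k1)) gk
  end.

Definition is_letter k (x : M k) : Prop :=
  exists2 j, (1 <= j <= k.-1)%N &
    [\/ x = ml k j, x = mr k j | x = me k j].

Definition is_word k (w : M k) : Prop :=
  exists2 s : seq (M k), (forall x, x \in s -> is_letter x)
                       & w = foldr (@mmul k) (mone k) s.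

End Algebra.

Arguments mone {F D n}.
Arguments mp {F D n} i.
Arguments ml {F D n} i.
Arguments mr {F D n} i.
Arguments me {F D n} i.

Declare Scope motzkin_scope.
Delimit Scope motzkin_scope with motz.
Notation "x ** y" := (mmul x y) (at level 40, left associativity)
  : motzkin_scope.

(* Main.v *)
Require Import Defs.
From HB Require Import structures.
From mathcomp Require Import all_boot all_order all_algebra fingroup perm.
From mathcomp Require Import zify ring.

Set Implicit Arguments.
Unset Strict Implicit.
Unset Printing Implicit Defensive.

Import GRing.Theory.

(** The argument has a combinatorial and an algebraic half.

    Combinatorics. Color the boundary points of a diagram from a finite set with
    a distinguished trivial color, and call a coloring compatible when joined
    points have equal colors and isolated points the trivial one. Stack x above
    y and fix the colors of the outer points. The compatible colors of the
    middle points number N ^ kappa(x, y), N being the number of colors, if the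
    outer coloring is compatible with the stacked diagram, and 0 otherwise
    ([card_middle]). Indeed every component of the stacked picture is a closed
    loop, whose color is free, or a path (possibly a single point) with exactly
    two ends, each an outer point or a dead end ([card_free_sides]). So colorings turn diagrams into 0-1
    matrices, with stacking as matrix product up to N ^ kappa. Two colors already
    determine the diagram and the exponent ([weight_inj]), so every identity
    between diagrams and loop numbers (associativity, the relations between
    generators, the behaviour of inclusion, reflection and closing up) becomes
    an identity between sums over colorings. The product with parameter D is
    therefore associative although D is arbitrary.

    Planarity is handled by colors too. When the two non-trivial colors act as
    non-commuting involutions of a group, a partial matching is noncrossing if
    and only if, for each compatible coloring, the products along the top and
    along the bottom agree ([is_motzkinP]). This condition clearly survives
    stacking, padding, reflecting and closing up.

    Algebra. Writing g for g_k in M_(k+1), p for p_(k+1), e for e_k and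
    c for the coefficient of the recursion, g' = g (1 - p) - c g e g. One carries
    along that g kills each p_i and e_i, is a self-adjoint idempotent, absorbs
    g_(k-1), and has expectation c^-1 g_(k-1). The key facts are p e = p_k e,
    whence g p e = 0, and e g e = E(g) e, whence c g e g e = g e and g' e = 0;
    idempotence follows, and the bimodule property of E gives E(g'). Finally
    l_i = p_(i+1) l_i and r_i = p_i r_i are killed because the p_i are, and the
    p_i are words because p_i = r_i l_i and p_(i+1) = l_i r_i. A non-empty word
    is never 1 since no letter has a right inverse ([letter_mul_neq1]). *)

(** * Alternating walks *)

(** Two involutions [f true] and [f false] are walked alternately: [turn] sends
    a vertex, together with the involution to be used next, to its image, and
    [flip] reverses the direction of travel. A walk bounces at the fixed points
    of the involutions, which are its ends: there [turn x = flip x]. *)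
Section AlternatingWalk.

Variables (V : finType) (f : bool -> V -> V).
Hypothesis fK : forall b, involutive (f b).

Definition turn (x : V * bool) : V * bool := (f x.2 x.1, ~~ x.2).
Definition flip (x : V * bool) : V * bool := (x.1, ~~ x.2).

Lemma turn_flip_turn x : turn (flip (turn x)) = flip x.
Proof. by case: x => v b; rewrite /turn /flip /= negbK fK. Qed.

Lemma flipK : involutive flip.
Proof. by case=> v b; rewrite /flip /= negbK. Qed.

Lemma turn_inj : injective turn.
Proof.
move=> x y e; apply: (can_inj flipK).
by rewrite -turn_flip_turn e turn_flip_turn.
Qed.

Lemma iter_turn_flip i x :
  iter i turn (flip (iter i turn x)) = flip x.
Proof.
elim: i x => // i IHi x.
by rewrite iterSr iterS turn_flip_turn IHi.
Qed.

Lemma iter_turn2 i x : (iter i turn x).2 = odd i (+) x.2.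
Proof. by elim: i => //= i ->; rewrite addNb. Qed.

Lemma odd_order_turn x : odd (fingraph.order turn x) = false.
Proof.
have /(congr1 snd) := iter_order turn_inj x.
by rewrite iter_turn2; case: odd => //; case: x.2.
Qed.

(** Two ends on the same cycle are half a cycle apart. *)
Lemma end_iterE x i : turn x = flip x ->
    turn (iter i turn x) = flip (iter i turn x) <-> iter i.*2 turn x = x.
Proof.
move=> xE; have := iter_turn_flip i x; rewrite -xE => yE.
rewrite -addnn; split=> [e|e].
  by apply: turn_inj; rewrite -yE -e -iterSr -iterS -!iterD addSn.
have iter_inj : injective (iter i turn).
  by elim: i {e yE} => // i IHi u v /turn_inj /IHi.
apply: iter_inj; rewrite yE.
by rewrite -iterSr -iterD addSn iterS e.
Qed.

Lemma card_ends x : turn x = flip x ->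
  #|[pred y | fconnect turn x y & turn y == flip y]| = 2.
Proof.
move=> xE; set L := fingraph.order turn x.
have L0 : (0 < L)%N by by rewrite /L -orderSpred.
have L2 : L = (L./2).*2 by rewrite -[LHS]odd_double_half odd_order_turn.
have ltL2 : (L./2 < L)%N by rewrite {2}L2; lia.
have nez : x != iter L./2 turn x.
  apply/eqP=> e; have := findex_iter ltL2; rewrite -e findex0; lia.
rewrite -[2]/(true.+1) -nez -cards2; apply: eq_card => y; rewrite !inE.
apply/andP/orP=> [[xy /eqP yE]|].
  have lti := findex_max xy; move: yE; rewrite -(iter_findex xy).
  set i := findex turn x y in lti *.
  rewrite end_iterE // => e.
  case: (ltnP i.*2 L) => [lt2|le2].
    have := findex_iter lt2; rewrite e findex0 => e0.
    by left; have -> : i = 0%N by lia.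
  right; have lt2 : (i.*2 - L < L)%N by rewrite -/L in lti; lia.
  have := findex_iter lt2.
  rewrite -[x in iter _ _ x](iter_order turn_inj) -/L -iterD subnK // e.
  by rewrite findex0 => e0; have -> : i = L./2 by lia.
case=> /eqP->; first by rewrite connect0 xE.
rewrite fconnect_iter; split=> //; apply/eqP/end_iterE => //.
by rewrite -L2 iter_order //; apply: turn_inj.
Qed.

Lemma fconnect_turn_flip x y : turn x = flip x ->
  fconnect turn x y -> fconnect turn x (flip y).
Proof.
move=> xE /iter_findex <-; set i := findex _ _ _.
rewrite (same_fconnect1 turn_inj) xE (fconnect_sym turn_inj).
by rewrite -(iter_turn_flip i x) fconnect_iter.
Qed.

End AlternatingWalk.

(** * Contracting the union of two matchings *)

(** Partial matchings of a finite set, as symmetric relations. *)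
Definition matching (V : Type) (A : rel V) :=
  [/\ irreflexive A, symmetric A & forall u v w, A u v -> A u w -> v = w].

Section Contraction.

(** [A] and [B] are partial matchings and [O] is a set of outer vertices, each
    used by at most one of them. *)
Variables (V : finType) (A B : rel V) (O : pred V).
Hypotheses (Am : matching A) (Bm : matching B).

(** [v] is joined by [A] (if [b]) or by [B] (otherwise) to some vertex. *)
Definition used (b : bool) (v : V) := [exists w, (if b then A else B) v w].

Hypothesis outer_free : forall v, O v -> ~~ (used true v && used false v).

Local Notation e := (fun u v : V => A u v || B u v).

(** The involution of a matching; it fixes the unmatched vertices. *)
Definition partner (b : bool) (v : V) : V :=
  odflt v [pick w | (if b then A else B) v w].

Lemma matching_cond b : matching (if b then A else B).
Proof. by case: b. Qed.

Lemma partnerP b v w : (if b then A else B) v w -> partner b v = w.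
Proof.
have [_ _ fE] := matching_cond b.
rewrite /partner => vw; case: pickP => [z vz|/(_ w)]; last by rewrite vw.
exact: fE vz vw.
Qed.

Lemma partner_free b v : (partner b v == v) = ~~ used b v.
Proof.
have [iE _ _] := matching_cond b.
rewrite /partner /used; case: pickP => [w vw|no] /=.
  apply/eqP/negP => [wv|[]]; first by move: vw; rewrite wv iE.
  by apply/existsP; exists w.
by rewrite eqxx; apply/esym/negP => /existsP[w]; rewrite no.
Qed.

Lemma partnerK b : involutive (partner b).
Proof.
move=> v; have [_ sE _] := matching_cond b.
case: (boolP (used b v)) => [/existsP[w vw]|].
  by rewrite (partnerP vw); apply: partnerP; rewrite sE.
by rewrite -partner_free => /eqP e; rewrite !e.
Qed.

Lemma union_sym : connect_sym e.
Proof.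
apply: sym_connect_sym => u v; have [_ sA _] := Am; have [_ sB _] := Bm.
by rewrite sA sB.
Qed.

(** The free sides of the vertices of the component of [v]. *)
Definition free_sides v :=
  [pred y : V * bool | connect e v y.1 & ~~ used y.2 y.1].

Lemma end_free y : (turn partner y == flip y) = ~~ used y.2 y.1.
Proof. by case: y => w b; rewrite /turn /flip xpair_eqE eqxx andbT partner_free. Qed.

Lemma connect_partner b w : connect e w (partner b w).
Proof.
case: (boolP (used b w)) => [/existsP[z wz]|].
  by rewrite (partnerP wz); apply: connect1; case: b wz => ->; rewrite ?orbT.
by rewrite -partner_free => /eqP->.
Qed.

(** A component is a loop, an isolated vertex, or a path. *)
Lemma card_free_sides v y : y \in free_sides v -> #|free_sides v| = 2.
Proof.
rewrite !inE => /andP[vy yF].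
have yE : turn partner y = flip y by apply/eqP; rewrite end_free.
rewrite -(card_ends partnerK yE); apply: eq_card => x; rewrite !inE -end_free.
congr (_ && _); rewrite (same_connect union_sym vy).
apply/idP/idP => [|/iter_findex <-].
  have cl : forall w z, connect e w z -> fconnect (turn partner) y (w, true) ->
      fconnect (turn partner) y (z, true).
    move=> w z /connectP[p]; elim: p w => [|t p IHp] w /= => [_ -> //|].
    case/andP=> wt pth zE yw; apply: (IHp t pth zE).
    case/orP: wt => wt.
      have -> : (t, true) = flip (turn partner (w, true)).
        by rewrite /turn /flip /= (@partnerP true _ _ wt).
      apply: (fconnect_turn_flip partnerK) => //.
      exact: connect_trans yw (fconnect1 _ _).
    have -> : (t, true) = turn partner (flip (w, true)).
      by rewrite /turn /flip /= (@partnerP false _ _ wt).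
    apply: connect_trans (fconnect1 _ _).
    exact: (fconnect_turn_flip partnerK yE).
  move=> yx; have := cl _ _ yx.
  have flipP z b : fconnect (turn partner) y (z, ~~ b) ->
      fconnect (turn partner) y (z, b).
    by move/(fconnect_turn_flip partnerK yE); rewrite /flip /= negbK.
  have /[swap]/[apply] : fconnect (turn partner) y (y.1, true).
    case: (y) yE flipP {cl yx} => z [] yE flipP; first exact: connect0.
    by apply: flipP; exact: connect0.
  by case: (x) => z [] //= h; apply: flipP.
set i := findex _ _ _; elim: i => //= i IHi.
exact: connect_trans IHi (connect_partner _ _).
Qed.

Lemma no_three_sides v x y z : x \in free_sides v -> y \in free_sides v ->
  z \in free_sides v -> ~~ uniq [:: x; y; z].
Proof.
move=> xv yv zv; apply/negP => us; suff : (3 <= #|free_sides v|)%N.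
  by rewrite (card_free_sides xv).
rewrite -[3]/(size [:: x; y; z]) -(card_uniqP us).
by apply/subset_leq_card/subsetP=> t; rewrite !in_cons orbF => /or3P[] /eqP->.
Qed.

(** A vertex that forces the color of its component to be trivial: an inner
    vertex with a free side or an outer vertex without strings. *)
Definition dead v :=
  if O v then ~~ used true v && ~~ used false v
  else ~~ (used true v && used false v).

Lemma dead_free w : dead w -> exists b, ~~ used b w.
Proof.
rewrite /dead; case: ifP => _; first by case/andP=> F _; exists true.
by rewrite negb_and => /orP[]; [exists true | exists false].
Qed.

Lemma outer_side w : O w -> exists b, ~~ used b w.
Proof.
by move/outer_free; rewrite negb_and => /orP[]; [exists true | exists false].
Qed.

(** A component with a single outer vertex contains a dead vertex, because its
    second free side must be somewhere. *)
Lemma lone_dead u : O u -> (forall v, O v -> connect e u v -> v = u) ->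
  exists2 w, connect e u w & dead w.
Proof.
move=> Ou lone; have [b ub] := outer_side Ou.
have uF : (u, b) \in free_sides u by rewrite !inE connect0.
have /card_gt0P [[w b']] : (0 < #|[predD1 free_sides u & (u, b)]|)%N.
  by have := cardD1 (u, b) (free_sides u); rewrite (card_free_sides uF) uF /= add1n => -[<-].
rewrite !inE /= => /and3P[nub uw wb']; exists w => //.
rewrite /dead; case: ifP => Ow.
  move: nub; rewrite (lone _ Ow uw) in wb' *.
  by rewrite xpair_eqE eqxx /=; case: b b' ub wb' {uF} => [] [] // -> ->.
by case: b' wb' {nub} => /negPf->; rewrite ?andbF.
Qed.

(** Two outer vertices use up both free sides of their component. *)
Lemma outer_pair_not_dead u v w : O u -> O v -> u != v -> connect e u v ->
  connect e u w -> ~~ dead w.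
Proof.
move=> Ou Ov nuv uv uw; apply/negP => dw.
have [bu uF] := outer_side Ou; have [bv vF] := outer_side Ov.
case: (eqVneq w u) dw => [-> /[dup] |nwu].
  rewrite {1}/dead Ou => /andP[u1 u2] _.
  have := @no_three_sides u (u, true) (u, false) (v, bv).
  by rewrite /= !inE !xpair_eqE eqxx (negPf nuv) connect0 uv u1 u2 vF => /(_ isT isT isT).
case: (eqVneq w v) => [-> /[dup] |nwv].
  rewrite {1}/dead Ov => /andP[u1 u2] _.
  have := @no_three_sides u (v, true) (v, false) (u, bu).
  rewrite /= !inE !xpair_eqE eqxx [v == u]eq_sym (negPf nuv) connect0 uv u1 u2 uF.
  by move=> /(_ isT isT isT).
move=> /dead_free[bw wF].
have := @no_three_sides u (u, bu) (v, bv) (w, bw).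
rewrite /= !inE !xpair_eqE (negPf nuv) [u == w]eq_sym (negPf nwu).
rewrite [v == w]eq_sym (negPf nwv) connect0 uv uw uF vF wF.
by move=> /(_ isT isT isT).
Qed.

Lemma outer_pair_only u v w : O u -> O v -> O w -> u != v -> connect e u v ->
  connect e u w -> w = u \/ w = v.
Proof.
move=> Ou Ov Ow nuv uv uw.
have [bu uF] := outer_side Ou; have [bv vF] := outer_side Ov.
have [bw wF] := outer_side Ow.
case: (eqVneq w u) => [->|nwu]; first by left.
case: (eqVneq w v) => [->|nwv]; first by right.
have := @no_three_sides u (u, bu) (v, bv) (w, bw).
rewrite /= !inE !xpair_eqE (negPf nuv) [u == w]eq_sym (negPf nwu).
rewrite [v == w]eq_sym (negPf nwv) connect0 uv uw uF vF wF.
by move=> /(_ isT isT isT).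
Qed.

Variables (C : finType) (c0 : C).

(** Colorings of the vertices, [c0] being the trivial color: constant along the
    strings and trivial at dead vertices. *)
Definition valid (h : {ffun V -> C}) :=
  [forall u, forall v, e u v ==> (h u == h v)] &&
  [forall v, dead v ==> (h v == c0)].

(** A coloring of the outer vertices respects the contracted matching, which
    joins distinct outer vertices of the same component: joined vertices have
    the same color and lone vertices the trivial one. *)
Definition outer_compat (f : V -> C) :=
  [forall u in O, forall v in O, connect e u v ==> (f u == f v)] &&
  [forall u in O, [forall v in O, connect e u v ==> (v == u)] ==> (f u == c0)].

(** The component of [v] is a closed loop. *)
Definition on_cycle v := [forall w, connect e v w ==> used true w && used false w].

Lemma on_cycle_connect v w : connect e v w -> on_cycle v = on_cycle w.
Proof.
by move=> vw; apply: eq_forallb => z; rewrite (same_connect union_sym vw).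
Qed.

Lemma dead_not_on_cycle v w : connect e v w -> dead w -> on_cycle v = false.
Proof.
move=> vw /dead_free[b wF]; apply/negP => /forallP/(_ w); rewrite vw /=.
by case: b wF => /negPf->; rewrite ?andbF.
Qed.

Lemma outer_not_on_cycle v w : connect e v w -> O w -> on_cycle v = false.
Proof.
move=> vw /outer_side[b wF]; apply/negP => /forallP/(_ w); rewrite vw /=.
by case: b wF => /negPf->; rewrite ?andbF.
Qed.

Lemma valid_connect h v w : valid h -> connect e v w -> h v = h w.
Proof.
case/andP=> /forallP hE _ /connectP[p]; elim: p v => [|t p IHp] v /=.
  by move=> _ ->.
case/andP=> vt pth wE; have /forallP/(_ t) := hE v; rewrite vt => /eqP->.
exact: IHp.
Qed.

Lemma valid_dead h v w : valid h -> connect e v w -> dead w -> h v = c0.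
Proof.
move=> hv vw dw; rewrite (valid_connect hv vw).
by case/andP: hv => _ /forallP/(_ w); rewrite dw => /eqP.
Qed.

(** Extending a coloring [f] of the outer vertices, given the colors [g] of the
    roots of the closed components. *)
Definition extend (f : V -> C) (g : {ffun V -> C}) : {ffun V -> C} :=
  [ffun v => if on_cycle v then g (fingraph.root e v)
             else if [pick u | O u & connect e v u] is Some u then f u else c0].

Lemma extend_valid f g : outer_compat f -> valid (extend f g).
Proof.
case/andP=> /forallP/= fE /forallP/= f0; apply/andP; split.
  apply/forallP=> u; apply/forallP=> v; apply/implyP=> uv.
  have cuv : connect e u v by exact: connect1.
  rewrite !ffunE (on_cycle_connect cuv).
  rewrite (fingraph.rootP union_sym cuv).
  by rewrite (eq_pick (fun z => congr1 (andb _) (same_connect union_sym cuv z))).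
apply/forallP=> v; apply/implyP=> dv.
rewrite ffunE (dead_not_on_cycle (connect0 _ v) dv).
case: pickP => [u /andP[Ou vu]|//].
have /implyP/(_ Ou)/implyP := f0 u; apply.
apply/forallP=> w; apply/implyP=> Ow; apply/implyP=> uw; apply/negPn/negP=> nwu.
have uv : connect e u v by rewrite union_sym.
have := @outer_pair_not_dead u w v Ou Ow; rewrite eq_sym => /(_ nwu uw uv).
by rewrite dv.
Qed.

Lemma extend_outer f g u : outer_compat f -> O u -> extend f g u = f u.
Proof.
case/andP=> /forallP/= fE _ Ou; rewrite ffunE.
rewrite (outer_not_on_cycle (connect0 _ u) Ou).
case: pickP => [v /andP[Ov uv]|/(_ u)]; last by rewrite Ou connect0.
by have /implyP/(_ Ou)/forallP/(_ v)/implyP/(_ Ov)/implyP/(_ uv)/eqP := fE u.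
Qed.

Lemma valid_outer_compat h f :
  valid h -> (forall u, O u -> h u = f u) -> outer_compat f.
Proof.
move=> hv hf; apply/andP; split; apply/forallP=> u; apply/implyP=> Ou.
  apply/forallP=> v; apply/implyP=> Ov; apply/implyP=> uv.
  by rewrite -!hf // (valid_connect hv uv).
apply/implyP=> /forallP lone; rewrite -hf //.
have [v Ov uv|w uw dw] := lone_dead Ou.
  by have /implyP/(_ Ov)/implyP/(_ uv)/eqP := lone v.
by rewrite (valid_dead hv uw dw).
Qed.

(** A coloring of the outer vertices extends if and only if it is compatible
    with the contracted matching; the colors of the closed components are then
    arbitrary. *)
Theorem card_valid (f : V -> C) :
  #|[pred h | valid h & [forall u in O, h u == f u]]| =
  (outer_compat f * #|C| ^ n_comp e on_cycle)%N.
Proof.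
case: (boolP (outer_compat f)) => [fc|nfc]; last first.
  rewrite mul0n; apply: eq_card0 => h; rewrite !inE.
  apply: contraNF nfc => /andP[hv /forallP hf].
  by apply: valid_outer_compat hv _ => u Ou; have /implyP/(_ Ou)/eqP := hf u.
rewrite mul1n -(card_pffun_on c0) -[LHS]cardsE -[RHS]cardsE.
set R := [set g in pffun_on _ _ _]; rewrite -(@card_in_imset _ _ (extend f) R).
  apply: eq_card => h; apply/idP/imsetP => [|[g gR ->]]; rewrite !inE.
    case/andP=> hv /forallP hf.
    exists [ffun v => if fingraph.roots e v && on_cycle v then h v else c0].
      rewrite inE; apply/pffun_onP; split; last by move=> ? _.
      by apply/supportP=> v; rewrite ffunE !inE => /negPf->.
    apply/ffunP=> v; rewrite !ffunE; case: ifP => vL.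
      rewrite (roots_root union_sym) -(on_cycle_connect (connect_root _ v)) vL.
      exact: valid_connect hv (connect_root _ _).
    case: pickP => [u /andP[Ou vu]|no].
      rewrite (valid_connect hv vu).
      by have /implyP/(_ Ou)/eqP := hf u.
    move/negbT: vL; rewrite negb_forall => /existsP[w]; rewrite negb_imply.
    case/andP=> vw wF; apply: (valid_dead hv vw).
    by have := no w; rewrite vw andbT /dead => ->.
  rewrite extend_valid //=; apply/forallP=> u; apply/implyP=> Ou.
  by rewrite extend_outer.
move=> g g'; rewrite !inE => /pffun_onP[/supportP gS _] /pffun_onP[/supportP g'S _].
move=> /ffunP E; apply/ffunP=> v.
case: (boolP (fingraph.roots e v && on_cycle v)) => vR; last by rewrite gS ?g'S.
have := E v; rewrite !ffunE; case/andP: vR => /eqP vR ->.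
by rewrite vR.
Qed.

End Contraction.

(** * Colorings of diagrams *)

(** The relation of being joined by a string. *)
Definition joined n (E : strings n) : rel (point n) := fun u v => (u, v) \in E.

Section Colorings.

Variables (C : finType) (c0 : C).

(** The coloring of the boundary given by those of its top and bottom. *)
Definition glue n (t b : {ffun 'I_n -> C}) (u : point n) : C :=
  match u with inl i => t i | inr i => b i end.

(** [compat E t b]: giving the colors [t] to the top points and [b] to the
    bottom points makes joined points equal and isolated points trivial. *)
Definition compat n (E : strings n) (t b : {ffun 'I_n -> C}) : bool :=
  [forall u, forall v, joined E u v ==> (glue t b u == glue t b v)] &&
  [forall u, ~~ [exists v, joined E u v] ==> (glue t b u == c0)].

Lemma compatP n (E : strings n) t b :
  reflect ((forall u v, joined E u v -> glue t b u = glue t b v) /\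
           (forall u, ~~ [exists v, joined E u v] -> glue t b u = c0))
          (compat E t b).
Proof.
apply: (iffP andP) => -[E1 E2]; split.
- by move=> u v uv; have /forallP/(_ v)/implyP/(_ uv)/eqP := forallP E1 u.
- by move=> u iu; have /implyP/(_ iu)/eqP := forallP E2 u.
- by apply/forallP=> u; apply/forallP=> v; apply/implyP=> uv; apply/eqP/E1.
by apply/forallP=> u; apply/implyP=> iu; apply/eqP/E2.
Qed.

Lemma compat_const n (E : strings n) : compat E [ffun=> c0] [ffun=> c0].
Proof. by apply/compatP; split=> [[i|i] [j|j]|[i|i]]; rewrite /= !ffunE. Qed.

(** ** Stacking *)

Section Stack.

Variables (n : nat) (x y : strings n).
Hypotheses (xm : matching (joined x)) (ym : matching (joined y)).

Local Notation A := (upper_edge x).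
Local Notation B := (lower_edge y).

Lemma in_upper_inj : injective (@in_upper n).
Proof. by case=> i [] j //= [->]. Qed.

Lemma in_lower_inj : injective (@in_lower n).
Proof. by case=> i [] j //= [->]. Qed.

Lemma upper_edgeP p q :
  reflect (exists u v, [/\ p = in_upper u, q = in_upper v & joined x u v]) (A p q).
Proof.
apply: (iffP existsP) => [[[u v] /and3P[uv /eqP-> /eqP->]]|[u [v [-> -> uv]]]].
  by exists u, v.
by exists (u, v); rewrite !eqxx !andbT.
Qed.

Lemma lower_edgeP p q :
  reflect (exists u v, [/\ p = in_lower u, q = in_lower v & joined y u v]) (B p q).
Proof.
apply: (iffP existsP) => [[[u v] /and3P[uv /eqP-> /eqP->]]|[u [v [-> -> uv]]]].
  by exists u, v.
by exists (u, v); rewrite !eqxx !andbT.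
Qed.

Lemma upper_matching : matching A.
Proof.
have [ix sx fx] := xm; split.
- move=> p; apply/upper_edgeP => -[u [v [-> /in_upper_inj <-]]].
  by rewrite ix.
- move=> p q; apply/upper_edgeP/upper_edgeP => -[u [v [-> -> uv]]];
  by exists v, u; rewrite sx.
move=> p q r /upper_edgeP[u [v [-> -> uv]]].
by move=> /upper_edgeP[u' [w [/in_upper_inj <- -> /(fx _ _ _ uv) ->]]].
Qed.

Lemma lower_matching : matching B.
Proof.
have [iy sy fy] := ym; split.
- move=> p; apply/lower_edgeP => -[u [v [-> /in_lower_inj <-]]].
  by rewrite iy.
- move=> p q; apply/lower_edgeP/lower_edgeP => -[u [v [-> -> uv]]];
  by exists v, u; rewrite sy.
move=> p q r /lower_edgeP[u [v [-> -> uv]]].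
by move=> /lower_edgeP[u' [w [/in_lower_inj <- -> /(fy _ _ _ uv) ->]]].
Qed.

(** The outer points of the stacked picture. *)
Definition outer (v : vertex n) : bool := if v is inl _ then true else false.

Lemma used_upper u : used A B true (in_upper u) = [exists v, joined x u v].
Proof.
apply/existsP/existsP => [[q /upper_edgeP[u' [v [/in_upper_inj<- _ uv]]]]|[v uv]].
  by exists v.
by exists (in_upper v); apply/upper_edgeP; exists u, v.
Qed.

Lemma used_lower u : used A B false (in_lower u) = [exists v, joined y u v].
Proof.
apply/existsP/existsP => [[q /lower_edgeP[u' [v [/in_lower_inj<- _ uv]]]]|[v uv]].
  by exists v.
by exists (in_lower v); apply/lower_edgeP; exists u, v.
Qed.

Lemma unused_upper i : used A B true (inl (inr i)) = false.
Proof. by apply/existsP=> -[q /upper_edgeP[[j|j] [v []]]]. Qed.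

Lemma unused_lower i : used A B false (inl (inl i)) = false.
Proof. by apply/existsP=> -[q /lower_edgeP[[j|j] [v []]]]. Qed.

Lemma outer_side_free v : outer v -> ~~ (used A B true v && used A B false v).
Proof.
by case: v => [[i|i]|i] // _; rewrite ?unused_upper ?unused_lower ?andbF.
Qed.

Definition dead_stack := dead A B outer.

Lemma dead_top i : dead_stack (inl (inl i)) = ~~ [exists v, joined x (inl i) v].
Proof. by rewrite /dead_stack /dead unused_lower andbT -used_upper. Qed.

Lemma dead_bottom i : dead_stack (inl (inr i)) = ~~ [exists v, joined y (inr i) v].
Proof. by rewrite /dead_stack /dead unused_upper -used_lower. Qed.

Lemma dead_middle i : dead_stack (inr i) =
  ~~ [exists v, joined x (inr i) v] || ~~ [exists v, joined y (inl i) v].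
Proof. by rewrite /dead_stack /dead negb_and -used_upper -used_lower. Qed.

(** The coloring of the stacked picture with middle points colored by [m]. *)
Definition stack_coloring (t b m : {ffun 'I_n -> C}) : {ffun vertex n -> C} :=
  [ffun v => match v with inl u => glue t b u | inr i => m i end].

Lemma valid_stack t b m : valid A B outer c0 (stack_coloring t b m) =
  compat x t m && compat y m b.
Proof.
set h := stack_coloring t b m.
have hx u : h (in_upper u) = glue t m u by case: u => i; rewrite ffunE.
have hy u : h (in_lower u) = glue m b u by case: u => i; rewrite ffunE.
apply/idP/andP => [hv|[/compatP[x1 x2] /compatP[y1 y2]]].
  have hd v : dead_stack v -> h v = c0.
    by move=> dv; exact: valid_dead hv (connect0 _ v) dv.
  split; apply/compatP; split=> [u v uv|u].
  - rewrite -!hx; apply: valid_connect hv _; apply: connect1.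
    by apply/orP; left; apply/upper_edgeP; exists u, v.
  - rewrite -hx => iu; apply: hd; case: u iu => i iu; rewrite ?dead_top //.
    by rewrite dead_middle iu.
  - rewrite -!hy; apply: valid_connect hv _; apply: connect1.
    by apply/orP; right; apply/lower_edgeP; exists u, v.
  rewrite -hy => iu; apply: hd; case: u iu => i iu; rewrite ?dead_bottom //.
  by rewrite dead_middle iu orbT.
apply/andP; split; apply/forallP=> p; last first.
  rewrite -/(dead_stack p); apply/implyP; case: p => [[i|i]|i].
  - by rewrite dead_top ffunE => /x2 /= ->.
  - by rewrite dead_bottom ffunE => /y2 /= ->.
  by rewrite dead_middle ffunE => /orP[/x2|/y2] /= ->.
apply/forallP=> q; apply/implyP=> /orP[/upper_edgeP|/lower_edgeP].
  by case=> u [v [-> -> uv]]; rewrite !hx (x1 _ _ uv).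
by case=> u [v [-> -> uv]]; rewrite !hy (y1 _ _ uv).
Qed.

Lemma stack_connect u v : u != v -> connect (stack_edge x y) (inl u) (inl v) ->
  joined (stack x y) u v.
Proof. by move=> nuv uv; rewrite /joined inE nuv. Qed.

Lemma outer_compat_stack t b (f : vertex n -> C) :
    (forall u, f (inl u) = glue t b u) ->
  outer_compat A B outer c0 f = compat (stack x y) t b.
Proof.
move=> fE; apply/andP/compatP => -[f1 f2]; split.
- move=> u v; rewrite /joined inE /= => /andP[_ uv].
  have /forallP/(_ (inl v)) := forallP f1 (inl u).
  by rewrite uv !fE => /eqP.
- move=> u iu; have := forallP f2 (inl u); rewrite fE /= => /implyP h.
  apply/eqP/h; apply/forallP=> -[v|i] //=; apply/implyP => uv.
  apply: contraNT iu => nvu; apply/existsP; exists v; apply: stack_connect => //.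
  by rewrite eq_sym.
- apply/forallP=> -[u|i] //=; apply/forallP=> -[v|i] //=; apply/implyP=> uv.
  rewrite !fE; case: (eqVneq u v) => [->//|nuv].
  by apply/eqP/f1/stack_connect.
apply/forallP=> -[u|i] //=; apply/implyP=> /forallP lone; rewrite fE.
apply/eqP/f2/existsP => -[v]; rewrite /joined inE /= => /andP[nuv uv].
by have /= := lone (inl v); rewrite uv (inj_eq (@inl_inj _ _)) eq_sym (negPf nuv).
Qed.

(** Composing colorings through the middle points counts the closed loops. *)
Theorem card_middle t b :
  #|[pred m | compat x t m && compat y m b]| =
  (compat (stack x y) t b * #|C| ^ kappa x y)%N.
Proof.
pose f (v : vertex n) := if v is inl u then glue t b u else c0.
rewrite -(@outer_compat_stack _ _ f) // -[kappa x y]/(n_comp _ (on_cycle A B)).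
rewrite -(card_valid upper_matching lower_matching outer_side_free).
rewrite -(@card_imset _ _ (stack_coloring t b)); last first.
  move=> m m' /ffunP E; apply/ffunP=> i.
  by have := E (inr i); rewrite !ffunE.
apply: eq_card => h; apply/imsetP/idP => [[m + ->]|]; rewrite inE.
  rewrite -valid_stack inE => ->; apply/forallP=> -[u|i] //=.
  by rewrite ffunE.
case/andP=> hv /forallP hf.
have hE : h = stack_coloring t b [ffun i => h (inr i)].
  apply/ffunP=> -[u|i]; rewrite !ffunE //.
  by have /= /eqP := hf (inl u).
by exists [ffun i => h (inr i)] => //; rewrite inE -valid_stack -hE.
Qed.

Lemma stack_matching : matching (joined (stack x y)).
Proof.
have sym u v : connect (stack_edge x y) u v = connect (stack_edge x y) v u.
  exact: (union_sym upper_matching lower_matching).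
split=> [u|u v|u v w]; rewrite /joined !inE /= ?eqxx //.
  by rewrite eq_sym sym.
case/andP=> nuv uv /andP[nuw uw].
have := outer_pair_only upper_matching lower_matching outer_side_free.
move=> /(_ (inl u) (inl v) (inl w) isT isT isT); rewrite (inj_eq (@inl_inj _ _)).
case=> // -[wE]; last by rewrite wE.
by rewrite wE eqxx in nuw.
Qed.

End Stack.

(** ** Restricting and extending colorings *)

(** The colors of the first [m] points. *)
Definition restr m n (le_mn : m <= n) (t : {ffun 'I_n -> C}) : {ffun 'I_m -> C} :=
  [ffun i => t (widen_ord le_mn i)].

(** The coloring [s] of the first [m] points, continued by [t]. *)
Definition overlay m n (t : {ffun 'I_n -> C}) (s : {ffun 'I_m -> C}) :
    {ffun 'I_n -> C} :=
  [ffun i : 'I_n => if insub (i : nat) is Some j then s j else t i].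

(** [t] and [b] agree outside the first [m] points. *)
Definition same_tail m n (t b : {ffun 'I_n -> C}) : bool :=
  [forall i : 'I_n, (m <= i) ==> (t i == b i)].

Lemma same_tailP m n (t b : {ffun 'I_n -> C}) :
  reflect (forall i : 'I_n, m <= i -> t i = b i) (same_tail m t b).
Proof.
by apply: (iffP forallP) => h i; [move=> mi; have := h i; rewrite mi => /eqP |
  apply/implyP=> mi; rewrite h].
Qed.

Lemma overlay_widen m n (le_mn : m <= n) t (s : {ffun 'I_m -> C}) i :
  overlay t s (widen_ord le_mn i) = s i.
Proof. by rewrite ffunE /= insubT // => lt_im; congr (s _); apply: val_inj. Qed.

Lemma overlay_tail m n t (s : {ffun 'I_m -> C}) (i : 'I_n) :
  m <= i -> overlay t s i = t i.
Proof. by move=> mi; rewrite ffunE insubF // ltnNge mi. Qed.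

Lemma overlayK m n (le_mn : m <= n) t : cancel (@overlay m n t) (restr le_mn).
Proof. by move=> s; apply/ffunP=> i; rewrite ffunE overlay_widen. Qed.

Lemma same_tail_overlay m n t (s : {ffun 'I_m -> C}) :
  same_tail m (overlay (n := n) t s) t.
Proof. by apply/same_tailP=> i; apply: overlay_tail. Qed.

Lemma same_tail_sym m n (t b : {ffun 'I_n -> C}) :
  same_tail m t b = same_tail m b t.
Proof. by apply: eq_forallb => i; rewrite eq_sym. Qed.

Lemma overlay_restr m n (le_mn : m <= n) t b :
  same_tail m t b -> overlay t (restr le_mn b) = b.
Proof.
move/same_tailP=> tb; apply/ffunP=> i; case: (ltnP i m) => im.
  have -> : i = widen_ord le_mn (Ordinal im) by apply: val_inj.
  by rewrite overlay_widen ffunE.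
by rewrite overlay_tail // tb.
Qed.

(** ** Adding vertical strings *)

Lemma joined_pad m n (le_mn : m <= n) (E : strings m) u v :
  joined (pad le_mn E) u v <->
  (exists u' v', [/\ u = widen_point le_mn u', v = widen_point le_mn v'
                   & joined E u' v']) \/
  (exists i : 'I_n, m <= i /\
     (u = inl i /\ v = inr i \/ u = inr i /\ v = inl i)).
Proof.
rewrite /joined !inE; split=> [/orP[/imsetP[[u' v'] uv' [-> ->]]|]|].
- by left; exists u', v'.
- by case: u v => i [] j //= /andP[/eqP[/ord_inj ij] mi]; right; exists i;
    rewrite ij in mi *; auto.
case=> [[u' [v' [-> -> uv']]]|[i [mi [[-> ->]|[-> ->]]]]].
- by apply/orP; left; apply/imsetP; exists (u', v').
- by rewrite /= eqxx ltnS mi orbT.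
by rewrite /= eqxx ltnS mi orbT.
Qed.

Lemma widen_point_inj m n (le_mn : m <= n) : injective (widen_point le_mn).
Proof. by case=> i [] j //= [ij]; congr (_ _); apply: val_inj. Qed.

Lemma widen_point_tail m n (le_mn : m <= n) u (i : 'I_n) : m <= i ->
  (widen_point le_mn u == inl i = false) * (widen_point le_mn u == inr i = false).
Proof.
by move=> mi; split; apply/eqP; case: u => j //= [] /(congr1 val) /= ji;
  move: mi; rewrite -ji leqNgt ltn_ord.
Qed.

Lemma pad_matching m n (le_mn : m <= n) (E : strings m) :
  matching (joined E) -> matching (joined (pad le_mn E)).
Proof.
case=> iE sE fE; split.
- move=> u; apply/negP=> /joined_pad[[u' [v' [-> /widen_point_inj <-]]]|].
    by rewrite iE.
  by case=> i [_ [[->]|[->]]].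
- suff sym u v : joined (pad le_mn E) u v -> joined (pad le_mn E) v u.
    by move=> u v; apply/idP/idP; apply: sym.
  case/joined_pad=> [[u' [v' [-> -> uv]]]|[i [mi uv]]]; apply/joined_pad.
    by left; exists v', u'; rewrite sE.
  by right; exists i; tauto.
move=> u v w /joined_pad[[u' [v' [-> -> uv]]]|[i [mi uv]]] /joined_pad[].
- by case=> u2 [w' [/widen_point_inj<- -> /(fE _ _ _ uv) ->]].
- by case=> i [mi [[/eqP]|[/eqP]]]; rewrite (widen_point_tail le_mn u' mi).
- case=> u' [w' [uE wE _]].
  by case: uv => -[uE' _]; move: uE; rewrite uE' => /esym/eqP;
    rewrite (widen_point_tail le_mn u' mi).
by case=> j [mj]; case: uv => -[-> ->] [] [] // [->] ->.
Qed.

Lemma compat_pad m n (le_mn : m <= n) (E : strings m) t b :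
  compat (pad le_mn E) t b =
  compat E (restr le_mn t) (restr le_mn b) && same_tail m t b.
Proof.
have gw u : glue (restr le_mn t) (restr le_mn b) u = glue t b (widen_point le_mn u).
  by case: u => i; rewrite /= ffunE.
apply/compatP/andP => [[j1 j2]|[/compatP[j1 j2] /same_tailP tb]]; split.
- apply/compatP; split=> [u v uv|u iu]; rewrite !gw.
    by apply/j1/joined_pad; left; exists u, v.
  apply: j2; apply: contra iu => /existsP[v /joined_pad[]].
    by case=> u' [v' [/widen_point_inj<- _ uv']]; apply/existsP; exists v'.
  by case=> i [mi [[/eqP]|[/eqP]]]; rewrite (widen_point_tail le_mn u mi).
- apply/same_tailP=> i mi; apply: (j1 (inl i) (inr i)); apply/joined_pad.
  by right; exists i; auto.
- move=> u v /joined_pad[[u' [v' [-> -> uv]]]|]; first by rewrite -!gw (j1 _ _ uv).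
  by case=> i [mi [[-> ->]|[-> ->]]] /=; rewrite tb.
move=> u iu; case: (ltnP (match u with inl i | inr i => i end) m) => um.
  have [u' uE] : exists u', u = widen_point le_mn u'.
    by case: u um {iu} => i im; [exists (inl (Ordinal im)) | exists (inr (Ordinal im))];
      congr (_ _); apply: val_inj.
  rewrite uE -gw; apply: j2; apply: contra iu => /existsP[v uv].
  by apply/existsP; exists (widen_point le_mn v); apply/joined_pad; left; exists u', v.
case/negP: iu; apply/existsP.
case: u um => i mi; [exists (inr i)|exists (inl i)];
  by apply/joined_pad; right; exists i; auto.
Qed.

(** ** Reflecting *)

(** Exchanging top and bottom. *)
Definition mirror n (u : point n) : point n :=
  match u with inl i => inr i | inr i => inl i end.

Lemma mirrorK n : involutive (@mirror n).
Proof. by case. Qed.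

Lemma joined_reflect n (E : strings n) u v :
  joined (reflect_strings E) u v = joined E (mirror u) (mirror v).
Proof.
apply/imsetP/idP => [[[u' v'] uv [-> ->]]|uv].
  by rewrite -/(mirror u') -/(mirror v') !mirrorK.
exists (mirror u, mirror v) => //=.
by rewrite -[X in (X, _)]mirrorK -[X in (_, X)]mirrorK.
Qed.

Lemma reflect_matching n (E : strings n) :
  matching (joined E) -> matching (joined (reflect_strings E)).
Proof.
case=> iE sE fE; split=> [u|u v|u v w]; rewrite !joined_reflect //.
by move=> uv /(fE _ _ _ uv) /(can_inj (@mirrorK n)).
Qed.

Lemma compat_reflect n (E : strings n) t b :
  compat (reflect_strings E) t b = compat E b t.
Proof.
have gm u : glue t b u = glue b t (mirror u) by case: u.
apply/compatP/compatP => -[j1 j2]; split=> [u v uv|u iu].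
- by have := j1 (mirror u) (mirror v); rewrite joined_reflect !gm !mirrorK; apply.
- have := j2 (mirror u); rewrite gm mirrorK; apply.
  apply: contra iu => /existsP[v]; rewrite joined_reflect mirrorK => uv.
  by apply/existsP; exists (mirror v).
- by rewrite !gm; apply: j1; rewrite -joined_reflect.
rewrite gm; apply: j2; apply: contra iu => /existsP[v uv].
by apply/existsP; exists (mirror v); rewrite joined_reflect mirrorK.
Qed.

(** ** Closing up the last string *)

Section Close.

Variables (k : nat) (E : strings k.+1).
Hypothesis Em : matching (joined E).

Local Notation L := (joined (last_string k.+1)).
Local Notation top := (inl ord_max : point k.+1).
Local Notation bot := (inr ord_max : point k.+1).

(** The points that survive the closing up of the last string. *)
Definition not_last (u : point k.+1) :=
  match u with inl i | inr i => i != ord_max end.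

Lemma joined_last u v : L u v <-> u = top /\ v = bot \/ u = bot /\ v = top.
Proof.
rewrite /joined inE; split=> [|[[-> ->]|[-> ->]]] /=; rewrite ?eqxx //.
by case: u v => i [] j //= /andP[/eqP[ik] /eqP[jk]]; [left|right];
  split; congr (_ _); apply: val_inj.
Qed.

Lemma last_matching : matching L.
Proof.
split.
- by move=> u; apply/negP=> /joined_last[[-> //]|[-> //]].
- by move=> u v; apply/idP/idP => /joined_last uv; apply/joined_last; tauto.
move=> u v w /joined_last uv /joined_last uw.
by case: uv uw => -[-> ->] [] -[] // _ ->.
Qed.

Lemma used_last u : used (joined E) L false u = ~~ not_last u.
Proof.
apply/existsP/idP => [[v /joined_last[] [-> _]]|]; rewrite /= ?eqxx //.
by case: u => i /negPn/eqP->; [exists bot | exists top]; apply/joined_last; auto.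
Qed.

Lemma not_last_free u : not_last u ->
  ~~ (used (joined E) L true u && used (joined E) L false u).
Proof. by rewrite used_last => ->; rewrite andbF. Qed.

Lemma dead_close u : dead (joined E) L not_last u = ~~ [exists v, joined E u v].
Proof. by rewrite /dead used_last; case: not_last; rewrite ?andbT. Qed.

Lemma glueE t b (h : {ffun point k.+1 -> C}) :
  valid (joined E) L not_last c0 h ->
  (forall u, h u = glue t b u) -> compat E t b.
Proof.
move=> hv hE; apply/compatP; split=> [u v uv|u iu]; rewrite -!hE.
  by apply: valid_connect hv _; apply: connect1; rewrite uv.
by apply: valid_dead hv (connect0 _ u) _; rewrite dead_close.
Qed.

Local Notation e := (fun u v => joined E u v || L u v).

Lemma close_connect u v :
  connect (fun p q => (p, q) \in E :|: last_string k.+1) u v = connect e u v.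
Proof. by apply: eq_connect => p q; rewrite inE. Qed.

Local Notation widen := (widen_point (leq_pred k.+1)).

Lemma not_last_widen u : not_last (widen u).
Proof. by case: u => i /=; rewrite -val_eqE /= ltn_eqF. Qed.

Lemma not_lastP u : not_last u -> exists u', u = widen u'.
Proof.
case: u => i /= il; have ik : i < k.+1.-1.
- by move: il; rewrite -val_eqE /=; have := ltn_ord i; lia.
- by exists (inl (Ordinal ik)); congr (_ _); apply: val_inj.
- by move: il; rewrite -val_eqE /=; have := ltn_ord i; lia.
by exists (inr (Ordinal ik)); congr (_ _); apply: val_inj.
Qed.

Lemma joined_close u v : joined (close_last E) u v =
  (u != v) && connect e (widen u) (widen v).
Proof. by rewrite /joined inE /= close_connect. Qed.

Lemma close_matching : matching (joined (close_last E)).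
Proof.
have sym := union_sym Em last_matching.
split=> [u|u v|u v w]; rewrite ?joined_close ?eqxx //; first by rewrite eq_sym sym.
case/andP=> nuv uv /andP[nuw uw].
have := outer_pair_only Em last_matching not_last_free (not_last_widen u)
  (not_last_widen v) (not_last_widen w).
rewrite (inj_eq (@widen_point_inj _ _ _)) => /(_ nuv uv uw).
by case=> /widen_point_inj wE //; rewrite wE eqxx in nuw.
Qed.

Lemma outer_compat_close t b (f : point k.+1 -> C) :
    (forall u, f (widen u) = glue t b u) ->
  outer_compat (joined E) L not_last c0 f = compat (close_last E) t b.
Proof.
move=> fE; apply/andP/compatP => -[f1 f2]; split.
- move=> u v; rewrite joined_close => /andP[_ uv].
  have /implyP/(_ (not_last_widen u)) := forallP f1 (widen u).
  move=> /forallP/(_ (widen v))/implyP/(_ (not_last_widen v)).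
  by rewrite uv !fE => /eqP.
- move=> u iu; have /implyP/(_ (not_last_widen u)) := forallP f2 (widen u).
  rewrite fE => /implyP h; apply/eqP/h; apply/forallP=> v'; apply/implyP=> /not_lastP.
  case=> v ->; apply/implyP => uv.
  apply: contraNT iu; rewrite (inj_eq (@widen_point_inj _ _ _)) => nvu.
  by apply/existsP; exists v; rewrite joined_close eq_sym nvu.
- apply/forallP=> u'; apply/implyP=> /not_lastP[u ->].
  apply/forallP=> v'; apply/implyP=> /not_lastP[v ->]; apply/implyP=> uv.
  rewrite !fE; case: (eqVneq u v) => [->//|nuv].
  by apply/eqP/f1; rewrite joined_close nuv.
apply/forallP=> u'; apply/implyP=> /not_lastP[u ->].
apply/implyP=> /forallP lone; rewrite fE.
apply/eqP/f2/existsP => -[v]; rewrite joined_close => /andP[nuv uv].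
have := lone (widen v); rewrite uv (inj_eq (@widen_point_inj _ _ _)) eq_sym.
by rewrite (negPf nuv) implybF => /negP; apply; exact: not_last_widen.
Qed.

Lemma n_comp_close :
  n_comp e (on_cycle (joined E) L) = close_loops E.
Proof.
have sym := union_sym Em last_matching.
have [iE sE fE] := Em.
have tb : connect e top bot.
  by apply: connect1; apply/orP; right; apply/joined_last; auto.
have cyc_last v : on_cycle (joined E) L v -> connect e top v.
  move=> cv; have := outer_not_on_cycle not_last_free (connect0 e v).
  rewrite cv; case: v {cv} => i /=;
  by case: (eqVneq i ord_max) => [-> _|_ /(_ isT)].
rewrite /close_loops; case: (boolP (last_string k.+1 \subset E)) => sub.
  have jtb : joined E top bot.
    have ltb : L top bot by apply/joined_last; left.
    exact: subsetP sub _ ltb.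
  rewrite -[RHS](n_comp_connect sym top); apply: eq_n_comp_r => v.
  rewrite ![v \in _]/in_mem /=; apply/idP/idP; first exact: cyc_last.
  have cl w z : e w z -> w \in [:: top; bot] -> z \in [:: top; bot].
    rewrite !inE => /orP[] wz /orP[] /eqP wE; move: wz; rewrite wE.
    - by move/(fE _ _ _ jtb) => <-; rewrite eqxx orbT.
    - by move/(fE _ _ top); rewrite sE => /(_ _)<- //; rewrite ?eqxx.
    - by case/joined_last=> -[] // _ ->; rewrite eqxx orbT.
    by case/joined_last=> -[] // _ ->; rewrite eqxx.
  move=> tv; apply/forallP=> w; apply/implyP=> vw.
  have : w \in [:: top; bot].
    have /closed_connect := intro_closed sym cl.
    by move/(_ top w (connect_trans tv vw)) => <-; rewrite mem_head.
  rewrite !inE => /orP[] /eqP->; rewrite used_last /= eqxx andbT.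
    by apply/existsP; exists bot.
  by apply/existsP; exists top; rewrite sE.
apply: eq_card0 => v; rewrite !inE; apply/negP=> /andP[_].
rewrite -[v \in _]/(on_cycle _ _ v) => cv.
have tv := cyc_last _ cv; have vt : connect e v top by rewrite sym.
have /forallP/(_ top)/implyP/(_ vt)/andP[/existsP[w tw] _] := cv.
have tw' : connect e v w.
  by apply: connect_trans vt (connect1 _); apply/orP; left.
have nw : not_last w = false.
  apply/negP=> nw.
  by have := outer_not_on_cycle not_last_free tw' nw; rewrite cv.
case/negP: sub; apply/subsetP=> -[p q] /joined_last pq.
have jtb : joined E top bot.
  move: nw tw; case: w {tw'} => i /=; case: (eqVneq i ord_max) => // -> _ //=.
  by rewrite iE.
by case: pq => -[-> ->] //; rewrite -/(joined E bot top) sE.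
Qed.

(** Summing over the color of the last string counts the closed loops. *)
Theorem card_close (t b : {ffun 'I_k -> C}) :
  #|[pred c | compat E (overlay [ffun=> c] t) (overlay [ffun=> c] b)]| =
  (compat (close_last E) t b * #|C| ^ close_loops E)%N.
Proof.
pose f (u : point k.+1) := glue (overlay [ffun=> c0] t) (overlay [ffun=> c0] b) u.
have fE u : f (widen u) = glue t b u.
  by case: u => i; rewrite /f /= (overlay_widen (leq_pred k.+1)).
pose h c := [ffun u => glue (overlay [ffun=> c] t : {ffun 'I_k.+1 -> C})
                            (overlay [ffun=> c] b) u].
have hw c u : h c (widen u) = glue t b u.
  by case: u => i; rewrite ffunE /= (overlay_widen (leq_pred k.+1)).
have ht c : h c top = c by rewrite ffunE /= overlay_tail // ffunE.
have hb c : h c bot = c by rewrite ffunE /= overlay_tail // ffunE.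
rewrite -(@outer_compat_close _ _ f) // -n_comp_close.
rewrite -(card_valid Em last_matching not_last_free).
rewrite -(@card_imset _ _ h); last by move=> c c' E'; rewrite -[c]ht E' ht.
apply: eq_card => g; apply/imsetP/idP => [[c + ->]|]; rewrite inE.
  case/compatP=> j1 j2; rewrite inE; apply/andP; split; last first.
    by apply/forallP=> u'; apply/implyP=> /not_lastP[u ->]; rewrite hw fE.
  apply/andP; split; apply/forallP=> u; last first.
    by rewrite dead_close; apply/implyP=> /j2; rewrite ffunE => ->.
  apply/forallP=> v; apply/implyP=> /orP[/j1|/joined_last].
    by rewrite !ffunE => ->.
  by case=> -[-> ->]; rewrite ht hb.
case/andP=> gv /forallP gf.
have gtb : g bot = g top.
  by apply: valid_connect gv _; apply: connect1; apply/orP; right;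
    apply/joined_last; auto.
have gE u : g u = h (g top) u.
  case: (boolP (not_last u)) => ul.
    have /implyP/(_ ul)/eqP -> := gf u.
    by have [u' ->] := not_lastP ul; rewrite hw fE.
  by case: u ul => i /negPn/eqP->; rewrite ?ht ?hb.
exists (g top); last by apply/ffunP.
by rewrite inE; apply: glueE gv _ => u; rewrite gE ffunE.
Qed.

End Close.

(** ** The generators *)

Lemma compat_diagP n (tt bb tb : rel nat) (t b : {ffun 'I_n -> C}) :
  reflect
    [/\ forall i j : 'I_n, tt i.+1 j.+1 -> t i = t j,
        forall i j : 'I_n, bb i.+1 j.+1 -> b i = b j,
        forall i j : 'I_n, tb i.+1 j.+1 -> t i = b j,
        forall i : 'I_n, (forall j : 'I_n, ~~ tt i.+1 j.+1) ->
          (forall j : 'I_n, ~~ tb i.+1 j.+1) -> t i = c0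
      & forall i : 'I_n, (forall j : 'I_n, ~~ bb i.+1 j.+1) ->
          (forall j : 'I_n, ~~ tb j.+1 i.+1) -> b i = c0]
    (compat (diag n tt bb tb) t b).
Proof.
have jE u v : joined (diag n tt bb tb) u v =
  match u, v with
  | inl i, inl j => tt i.+1 j.+1 | inr i, inr j => bb i.+1 j.+1
  | inl i, inr j => tb i.+1 j.+1 | inr j, inl i => tb i.+1 j.+1
  end by rewrite /joined inE; case: u v => i [].
apply: (iffP (compatP _ _ _)) => [[j1 j2]|[d1 d2 d3 d4 d5]]; split.
- by move=> i j h; apply: (j1 (inl i) (inl j)); rewrite jE.
- by move=> i j h; apply: (j1 (inr i) (inr j)); rewrite jE.
- by move=> i j h; apply: (j1 (inl i) (inr j)); rewrite jE.
- move=> i h1 h2; apply: (j2 (inl i)); apply/existsP=> -[[j|j]]; rewrite jE.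
    by apply/negP/h1.
  by apply/negP/h2.
- move=> i h1 h2; apply: (j2 (inr i)); apply/existsP=> -[[j|j]]; rewrite jE.
    by apply/negP/h2.
  by apply/negP/h1.
- by case=> i [] j; rewrite jE /= => h; rewrite ?(d1 _ _ h) ?(d2 _ _ h) //;
    rewrite (d3 _ _ h).
case=> i /existsP iu /=.
  by apply: d4 => j; apply/negP=> h; apply: iu; [exists (inl j)|exists (inr j)];
    rewrite jE.
by apply: d5 => j; apply/negP=> h; apply: iu; [exists (inr j)|exists (inl j)];
  rewrite jE.
Qed.

Lemma compat_one n (t b : {ffun 'I_n -> C}) :
  compat (diag n nostring nostring eq_op) t b = (t == b).
Proof.
apply/compat_diagP/eqP => [[_ _ d3 _ _]|->].
  by apply/ffunP=> i; apply: d3.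
split=> // [i j /eqP[/ord_inj->]|i _ /(_ i)|i _ /(_ i)] //; by rewrite eqxx.
Qed.

(** The [i]-th point, counted from 1, has the trivial color; no condition when
    there is no such point. *)
Definition trivial_at n i (t : {ffun 'I_n -> C}) :=
  [forall s : 'I_n, (s.+1 == i) ==> (t s == c0)].

Lemma compat_p n i (t b : {ffun 'I_n -> C}) :
  compat (diag n nostring nostring (fun s t => (s == t) && (s != i))) t b =
  trivial_at i t && (t == b).
Proof.
apply/compat_diagP/andP => [[_ _ d3 d4 d5]|[/forallP tr /eqP<-]].
  have t0 (s : 'I_n) : s.+1 = i -> t s = c0 /\ b s = c0.
    by move=> si; split; [apply: d4|apply: d5] => // j; apply/negP => /andP[]; lia.
  split; first by apply/forallP=> s; apply/implyP=> /eqP /t0[->].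
  apply/eqP/ffunP=> s; case: (eqVneq s.+1 i) => [/t0[-> ->] //|nsi].
  by apply: d3; rewrite eqxx.
split=> // [s j /andP[/eqP[/ord_inj->]]|s _ /(_ s)|s _ /(_ s)] //;
  by rewrite eqxx negbK => si; have := tr s; rewrite si => /eqP.
Qed.

Section Adjacent.

Variables (n : nat) (a a' : 'I_n).
Hypothesis a'E : a' = a.+1 :> nat.

(** Exchanging the colors of two adjacent points. *)
Definition swap (t : {ffun 'I_n -> C}) : {ffun 'I_n -> C} :=
  [ffun s => t (tperm a a' s)].

Lemma swapK : involutive swap.
Proof. by move=> t; apply/ffunP=> s; rewrite !ffunE tpermK. Qed.

Lemma compat_l (t b : {ffun 'I_n -> C}) :
  compat (l_strings n a.+1) t b = (t a' == c0) && (b == swap t).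
Proof.
apply/compat_diagP/andP => [[_ _ d3 d4 d5]|[/eqP ta /eqP->]].
  have ta : t a' = c0.
    apply: d4 => // j; apply/negP; rewrite /vertical_off.
    by have := ltn_ord j; lia.
  split; first exact/eqP.
  apply/eqP/ffunP=> s; rewrite ffunE; case: tpermP => [->|->|/eqP nsa /eqP nsa'].
  - rewrite ta; apply: d5 => // j; apply/negP; rewrite /vertical_off.
    by have := ltn_ord j; lia.
  - by apply/esym/d3; rewrite eqxx a'E eqxx.
  apply/esym/d3; rewrite /vertical_off eqxx.
  by move: nsa nsa'; rewrite -!val_eqE /=; lia.
split=> // [i j|i _ h|i _ h].
- rewrite ffunE => /orP[/andP[/eqP[/ord_inj->]] |].
    rewrite -a'E => /eqP[/ord_inj->].
    by rewrite tpermR.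
  case/and3P=> /eqP[/ord_inj<-]; rewrite !eqSS -a'E => n1 n2.
  by rewrite tpermD // -val_eqE eq_sym.
- have := h i; rewrite /vertical_off; have := h a'; rewrite /vertical_off.
  rewrite a'E => h1 h2; have iE : i = a' by apply: val_inj => /=; lia.
  by rewrite iE.
have := h i; rewrite /vertical_off; have := h a; rewrite /vertical_off.
move=> h1 h2; have iE : i = a by apply: val_inj => /=; lia.
by rewrite iE ffunE tpermL.
Qed.

Lemma compat_e (t b : {ffun 'I_n -> C}) :
  compat (diag n (cap a.+1) (cap a.+1) (vertical_off a.+1)) t b =
  [&& t a == t a', b a == b a'
    & [forall s, (s != a) && (s != a') ==> (t s == b s)]].
Proof.
have capE : cap a.+1 a.+1 a'.+1 by rewrite /cap a'E !eqxx.
apply/compat_diagP/and3P => [[d1 d2 d3 _ _]|[/eqP ta /eqP ba /forallP tb]].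
  split; [exact/eqP/d1|exact/eqP/d2|].
  apply/forallP=> s; apply/implyP; rewrite -!val_eqE /= => ns; apply/eqP/d3.
  by rewrite /vertical_off; lia.
have capP (i j : 'I_n) : cap a.+1 i.+1 j.+1 -> i = a /\ j = a' \/ i = a' /\ j = a.
  by rewrite /cap !eqSS -a'E => /orP[] /andP[/eqP/ord_inj-> /eqP/ord_inj->]; auto.
have offP (i : 'I_n) : i <> a -> i <> a' -> vertical_off a.+1 i.+1 i.+1.
  move=> /eqP + /eqP; rewrite -!val_eqE /vertical_off /= a'E; lia.
split.
- by move=> i j /capP[] [-> ->].
- by move=> i j /capP[] [-> ->].
- move=> i j /and3P[/eqP[/ord_inj<-]]; rewrite !eqSS -a'E => n1 n2.
  by have := tb i; rewrite -!val_eqE /= n1 n2 => /eqP.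
- move=> i h1 h2; case: (eqVneq i a) h1 => [->/(_ a')|/eqP ia]; first by rewrite capE.
  case: (eqVneq i a') => [->/(_ a)|/eqP ia' _]; first by rewrite /cap a'E !eqxx orbT.
  by have := h2 i; rewrite offP.
move=> i h1 h2; case: (eqVneq i a) h1 => [->/(_ a')|/eqP ia]; first by rewrite capE.
case: (eqVneq i a') => [->/(_ a)|/eqP ia' _]; first by rewrite /cap a'E !eqxx orbT.
by have := h2 i; rewrite offP.
Qed.

End Adjacent.

End Colorings.

Lemma diag_matching n (tt bb tb : rel nat) :
  matching tt -> matching bb ->
  (forall i j k, tb i j -> tb i k -> j = k) ->
  (forall i j k, tb i k -> tb j k -> i = j) ->
  (forall i j k, tt i j -> tb i k -> false) ->
  (forall i j k, bb i j -> tb k i -> false) ->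
  matching (joined (diag n tt bb tb)).
Proof.
move=> [it st ft] [ib sb fb] f1 f2 x1 x2.
have inj (i j : 'I_n) : i.+1 = j.+1 -> i = j by move=> [/ord_inj].
split.
- by case=> i; rewrite /joined inE ?it ?ib.
- by case=> i [] j; rewrite /joined !inE // ?(st _ i.+1) ?(sb _ i.+1).
case=> i [] j [] k; rewrite /joined !inE => h1 h2.
- by congr (_ _); apply: inj; apply: ft h1 h2.
- by have := x1 _ _ _ h1 h2.
- by have := x1 _ _ _ h2 h1.
- by congr (_ _); apply: inj; apply: f1 h1 h2.
- by congr (_ _); apply: inj; apply: f2 h1 h2.
- by have := x2 _ _ _ h2 h1.
- by have := x2 _ _ _ h1 h2.
by congr (_ _); apply: inj; apply: fb h1 h2.
Qed.

Lemma nostring_matching : matching nostring.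
Proof. by split. Qed.

Lemma cap_matching i : matching (cap i).
Proof. by split=> [u|u v|u v w]; rewrite /cap; lia. Qed.

Lemma one_matching n : matching (joined (diag n nostring nostring eq_op)).
Proof.
by apply: diag_matching nostring_matching nostring_matching _ _ _ _ => // i j k;
  move=> /eqP-> /eqP->.
Qed.

Lemma p_matching n i :
  matching (joined (diag n nostring nostring (fun s t => (s == t) && (s != i)))).
Proof.
by apply: diag_matching nostring_matching nostring_matching _ _ _ _ => // u v w;
  lia.
Qed.

Lemma l_matching n i : matching (joined (l_strings n i)).
Proof.
by apply: diag_matching nostring_matching nostring_matching _ _ _ _ => // u v w;
  rewrite /vertical_off; lia.
Qed.

Lemma e_matching n i :
  matching (joined (diag n (cap i) (cap i) (vertical_off i))).
Proof.
by apply: diag_matching (cap_matching i) (cap_matching i) _ _ _ _ => u v w;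
  rewrite /vertical_off /cap; lia.
Qed.

(** ** Colorings determine diagrams *)

(** Two colors suffice: the points colored [true] by the coloring that singles
    out [u] and [v] must be joined to each other. *)
Lemma compat_inj n (E E' : strings n) :
  matching (joined E) -> matching (joined E') ->
  (forall t b, compat false E t b = compat false E' t b) -> E = E'.
Proof.
suff sub (X Y : strings n) : matching (joined X) -> matching (joined Y) ->
    (forall t b, compat false X t b -> compat false Y t b) ->
    {subset X <= Y}.
  move=> Em Em' EE'; apply/setP=> uv; apply/idP/idP; apply: sub => // t b;
  by rewrite EE'.
move=> [iX sX fX] [iY sY fY] XY [u v] uv.
have vu : joined X v u by rewrite sX.
pose f w := (w == u) || (w == v).
pose t := [ffun i => f (inl i)]; pose b := [ffun i => f (inr i)].
have gE w : glue t b w = f w by case: w => i; rewrite /= ffunE.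
have /XY/compatP[y1 y2] : compat false X t b.
  apply/compatP; split=> [p q pq|p ip]; rewrite !gE /f.
    apply/orP/orP => -[] /eqP e; move: pq; rewrite e.
    - by move/(fX _ _ _ uv) => <-; right.
    - by move/(fX _ _ _ vu) => <-; left.
    - by rewrite sX => /(fX _ _ _ uv) <-; right.
    - by rewrite sX => /(fX _ _ _ vu) <-; left.
  apply/negP=> /orP[] /eqP e; move: ip; rewrite e; apply/negP/negPn/existsP.
    by exists v.
  by exists u.
case: (boolP [exists w, joined Y u w]) => [/existsP[w uw]|iu]; last first.
  by have := y2 u iu; rewrite gE /f eqxx.
have := y1 u w uw; rewrite !gE /f eqxx /= => /esym/orP[] /eqP wE.
  by move: uw; rewrite wE iY.
by move: uw; rewrite wE.
Qed.

(** * Planarity *)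

(** The two non-trivial colors, as non-commuting involutions. *)
Definition hue (c : option bool) : {perm 'I_3} :=
  match c with
  | None => 1
  | Some true => tperm 0%R 1%R
  | Some false => tperm 1%R 2%R
  end%g.

Lemma hueV c : (hue c * hue c = 1)%g.
Proof. by case: c => [[]|] /=; rewrite ?mulg1 ?tperm2. Qed.

Lemma hue_cross : (hue (Some true) * (hue (Some false) *
  (hue (Some true) * hue (Some false))) != 1)%g.
Proof.
apply/eqP=> /permP/(_ 0%R); rewrite !permM perm1 /=.
by rewrite tpermL tpermL [tperm 0%R 1%R _]tpermD // tpermR.
Qed.

(** A diagram is planar when, for every compatible coloring, the products of
    the colors of the top points and of the bottom points agree. Unlike the
    absence of crossings, this is visibly preserved by gluing diagrams. *)
Definition planar n (E : strings n) := forall t b, compat None E t b ->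
  (\prod_(i < n) hue (t i) = \prod_(i < n) hue (b i))%g.

(** The boundary points in clockwise order. *)
Definition boundary n : seq (point n) :=
  [seq inl i | i <- enum 'I_n] ++ [seq inr i | i <- rev (enum 'I_n)].

Lemma position_boundary n : map (@position n) (boundary n) = iota 0 (n + n).
Proof.
rewrite map_cat -(map_comp _ inl) -(map_comp _ inr) iotaD add0n; congr (_ ++ _).
  by rewrite -[iota 0 n]val_enum_ord; apply: eq_map.
rewrite map_rev (@eq_map _ _ _ (fun i : 'I_n => n + (n - i.+1))) //.
rewrite (map_comp (fun i => n + (n - i.+1)) val) val_enum_ord.
apply: (@eq_from_nth _ 0); first by rewrite size_rev size_map !size_iota.
rewrite size_rev size_map size_iota => i lt_in.
rewrite nth_rev ?size_map ?size_iota // (nth_map 0) ?size_iota; last by lia.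
rewrite !nth_iota //; lia.
Qed.

Lemma boundary_sorted n : sorted (relpre (@position n) ltn) (boundary n).
Proof. by rewrite -sorted_map position_boundary iota_ltn_sorted. Qed.

Lemma mem_boundary n u : u \in boundary n.
Proof.
by rewrite mem_cat; case: u => i; apply/orP; [left|right]; apply/map_f;
  rewrite ?mem_rev mem_enum.
Qed.

Lemma prod_rev (T : Type) (gT : finGroupType) (s : seq T) (F : T -> gT) :
  (\prod_(i <- rev s) F i = (\prod_(i <- s) (F i)^-1)^-1)%g.
Proof.
elim: s => [|x s IHs]; first by rewrite !big_nil invg1.
by rewrite rev_cons big_rcons big_cons IHs invMg invgK.
Qed.

Lemma prod_enum (gT : finGroupType) n (F : 'I_n -> gT) :
  (\prod_(i <- enum 'I_n) F i = \prod_(i < n) F i)%g.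
Proof. by rewrite enumT /index_enum unlock. Qed.

Lemma prod_boundary n (t b : {ffun 'I_n -> option bool}) :
  (\prod_(u <- boundary n) hue (glue t b u) =
   (\prod_(i < n) hue (t i)) * (\prod_(i < n) hue (b i))^-1)%g.
Proof.
rewrite big_cat (big_map inl) (big_map inr) prod_rev /= !prod_enum; congr (_ * _^-1)%g.
by apply: eq_bigr => i _; apply/eqP; rewrite eq_invg_mul hueV.
Qed.

(** The string at the first point splits a noncrossing word into two closed
    words, so by induction the colors cancel in pairs. *)
Lemma prod_noncrossing n (E : strings n) (f : point n -> option bool) l :
    matching (joined E) ->
    (forall u v w z, joined E u v -> joined E w z ->
      ~~ [&& position u < position w, position w < position v
           & position v < position z]) ->
    (forall u v, joined E u v -> f u = f v) ->
    (forall u, ~~ [exists v, joined E u v] -> f u = None) ->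
    pairwise (relpre (@position n) ltn) l ->
    (forall u v, u \in l -> joined E u v -> v \in l) ->
  (\prod_(u <- l) hue (f u) = 1)%g.
Proof.
move=> [iE sE fE] nc j1 j2; have [m] := ubnP (size l).
elim: m l => // m IHm [|u l] lt_m; first by rewrite big_nil.
rewrite pairwise_cons => /andP[/allP/= ul pl] cl; rewrite big_cons.
case: (boolP [exists v, joined E u v]) => [/existsP[v uv]|iu]; last first.
  rewrite (j2 _ iu) mul1g; apply: IHm => // w z wl wz.
  have := cl w z; rewrite !inE wl orbT => /(_ isT wz)/orP[/eqP zu|//].
  by case/existsP: iu; exists w; rewrite sE -zu.
have vl : v \in l.
  have := cl u v (mem_head _ _) uv; rewrite inE => /orP[/eqP vu|//].
  by rewrite vu iE in uv.
case/splitPr: l / vl lt_m ul pl cl => l1 l2; rewrite /= size_cat /= ltnS => lt_m ul.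
rewrite pairwise_cat /= => /and4P[/allrelP/= l12 p1 /allP/= vl2 p2] cl.
have lv w : w \in l1 -> position w < position v.
  by move=> wl; apply: l12; rewrite ?inE ?eqxx.
have other w z : w \in l1 ++ l2 -> joined E w z -> z \in l1 ++ l2.
  move=> wl wz; have : z \in u :: l1 ++ v :: l2.
    apply: cl wz; move: wl; rewrite inE !mem_cat inE.
    by case/orP=> ->; rewrite ?orbT.
  rewrite inE !mem_cat inE => /or4P[/eqP zu|->//|/eqP zv|->]; last by rewrite orbT.
    have wv : w = v by apply: fE uv; rewrite sE -zu.
    move: wl; rewrite wv mem_cat => /orP[/lv|/vl2]; by rewrite ltnn.
  have wu : w = u by apply: (fE v); rewrite sE // -zv.
  move: wl; rewrite wu => wl; suff : position u < position u by rewrite ltnn.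
  by apply: ul; move: wl; rewrite !mem_cat inE => /orP[]->; rewrite ?orbT.
have posu w : w \in l1 ++ l2 -> position u < position w.
  by move=> wl; apply: ul; move: wl; rewrite !mem_cat inE => /orP[]->; rewrite ?orbT.
have c1 w z : w \in l1 -> joined E w z -> z \in l1.
  move=> wl wz; have /other/(_ wz) : w \in l1 ++ l2 by rewrite mem_cat wl.
  rewrite mem_cat => /orP[//|zl]; have := nc u v w z uv wz.
  by rewrite posu ?mem_cat ?wl // lv //= vl2.
have c2 w z : w \in l2 -> joined E w z -> z \in l2.
  move=> wl wz; have /other/(_ wz) : w \in l1 ++ l2 by rewrite mem_cat wl orbT.
  rewrite mem_cat => /orP[zl|//]; have := nc u v z w uv; rewrite sE wz => /(_ isT).
  by rewrite posu ?mem_cat ?zl // lv //= vl2.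
have [lt1 lt2] : size l1 < m /\ size l2 < m.
  by rewrite addnS in lt_m; split; apply: leq_ltn_trans (ltnW lt_m);
    rewrite ?leq_addr ?leq_addl.
rewrite big_cat big_cons /= (IHm l1 lt1 p1 c1) (IHm l2 lt2 p2 c2).
by rewrite mulg1 mul1g (j1 _ _ uv) hueV.
Qed.

(** Well-formed diagrams: planar partial matchings. *)
Definition tangle n (E : strings n) := matching (joined E) /\ planar E.

(** For the converse, two crossing strings give the product [abab] of two
    non-commuting involutions, which is not 1. *)
Lemma is_motzkinP n (E : strings n) : reflect (tangle E) (is_motzkin E).
Proof.
apply: (iffP and4P) => [[/forallP i1 /forallP s1 /forallP f1 /forallP n1]|].
  have nc u v w z : joined E u v -> joined E w z ->
      ~~ [&& position u < position w, position w < position v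
           & position v < position z].
    move=> uv wz; have /forallP/(_ v)/forallP/(_ w)/forallP/(_ z) := n1 u.
    by rewrite -[_ \in _]/(joined E u v) uv -[_ \in _]/(joined E w z) wz.
  have Em : matching (joined E).
    split=> [u|u v|u v w uv uw]; first exact/negbTE/i1.
      by apply/idP/idP => uv; [have /forallP/(_ v)/implyP := s1 u
        | have /forallP/(_ u)/implyP := s1 v]; apply.
    have /forallP/(_ v)/forallP/(_ w)/implyP := f1 u.
    by rewrite -[_ \in _]/(joined E u v) uv => /(_ uw)/eqP.
  split=> // t b /compatP[j1 j2]; apply/eqP; rewrite eq_mulgV1 -prod_boundary.
  rewrite (prod_noncrossing Em nc j1 j2) // ?mem_boundary //.
    by rewrite -sorted_pairwise ?boundary_sorted // => u v w; apply: ltn_trans.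
  by move=> u v _ _; rewrite mem_boundary.
case=> -[iE sE fE] pE; split.
- by apply/forallP=> u; rewrite -[_ \in _]/(joined E u u) iE.
- by apply/forallP=> u; apply/forallP=> v; rewrite -![_ \in _]/(joined E _ _) sE implybb.
- apply/forallP=> u; apply/forallP=> v; apply/forallP=> w.
  by apply/implyP=> /andP[uv uw]; apply/eqP/(fE _ _ _ uv uw).
apply/forallP=> u; apply/forallP=> v; apply/forallP=> w; apply/forallP=> z.
apply/implyP=> /andP[uv wz]; apply/negP=> /and3P[uw wv vz].
have neq (p q : point n) : position p < position q -> (p == q = false) * (q == p = false).
  by move=> pq; rewrite eq_sym; split; apply/eqP=> e; rewrite e ltnn in pq.
have uv' := ltn_trans uw wv; have wz' := ltn_trans wv vz.
have uz' := ltn_trans uw wz'.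
have vu : joined E v u by rewrite sE.
have zw : joined E z w by rewrite sE.
(* The crossing strings get the two non-trivial colors. *)
pose f p := if (p == u) || (p == v) then Some true
            else if (p == w) || (p == z) then Some false else None.
pose t := [ffun i => f (inl i)]; pose b := [ffun i => f (inr i)].
have gE p : glue t b p = f p by case: p => i; rewrite /= ffunE.
have joinf p q : joined E p q ->
    ((p == u) || (p == v) -> (q == u) || (q == v)) /\
    ((p == w) || (p == z) -> (q == w) || (q == z)).
  move=> pq; split=> /orP[] /eqP pE'; rewrite pE' in pq; apply/orP.
  - by right; rewrite (fE _ _ _ pq uv).
  - by left; rewrite (fE _ _ _ pq vu).
  - by right; rewrite (fE _ _ _ pq wz).
  by left; rewrite (fE _ _ _ pq zw).
have : compat None E t b.
  apply/compatP; split=> [p q pq|p ip]; rewrite !gE /f.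
    have [h1 h2] := joinf _ _ pq; have qp : joined E q p by rewrite sE.
    have [h3 h4] := joinf _ _ qp.
    rewrite (_ : (p == u) || (p == v) = (q == u) || (q == v)); last exact/idP/idP.
    by rewrite (_ : (p == w) || (p == z) = (q == w) || (q == z)) //; apply/idP/idP.
  case: ifP => [/orP[]/eqP pE'|_]; [case/existsP: ip|case/existsP: ip|].
  - by exists v; rewrite pE'.
  - by exists u; rewrite pE'.
  case: ifP => [/orP[]/eqP pE'|//]; case/existsP: ip.
    by exists z; rewrite pE'.
  by exists w; rewrite pE'.
move/pE/eqP; rewrite eq_mulgV1 -prod_boundary => /eqP.
rewrite (eq_bigr (fun p => hue (f p))); last by move=> p _; rewrite gE.
rewrite -(@big_rmcond _ _ _ _ _ (fun p => f p != None)); last first.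
  by move=> p /negPn/eqP->.
rewrite -big_filter.
have -> : [seq p <- boundary n | f p != None] = [:: u; w; v; z].
  apply: (@irr_sorted_eq _ (relpre (@position n) ltn)).
  - by move=> p q r; apply: ltn_trans.
  - by move=> p; apply: ltnn.
  - apply: sorted_filter; last exact: boundary_sorted.
    by move=> p q r; apply: ltn_trans.
  - by rewrite /= uw wv vz.
  move=> p; rewrite mem_filter mem_boundary andbT !inE /f.
  by case: (p == u) (p == v) (p == w) (p == z) => [] [] [] [].
rewrite !big_cons big_nil /= mulg1 /f !eqxx !(neq _ _ uw) !(neq _ _ wv) !(neq _ _ vz).
rewrite !(neq _ _ uv') !(neq _ _ wz') !(neq _ _ uz') /= ?orbT.
by move/eqP; rewrite (negPf hue_cross).
Qed.

(** ** Planarity of the operations *)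

Lemma tangle_stack n (x y : strings n) :
  tangle x -> tangle y -> tangle (stack x y).
Proof.
move=> [xm xp] [ym yp]; split=> [|t b tb]; first exact: stack_matching.
have := card_middle None xm ym t b; rewrite tb mul1n => h.
have /card_gt0P[m] : 0 < #|[pred m | compat None x t m && compat None y m b]|.
  by rewrite h expn_gt0 card_option.
by rewrite inE => /andP[/xp-> /yp].
Qed.

Lemma tangle_reflect n (E : strings n) : tangle E -> tangle (reflect_strings E).
Proof.
move=> [Em Ep]; split=> [|t b]; first exact: reflect_matching.
by rewrite compat_reflect => /Ep.
Qed.

(** A family indexed by ['I_n], extended by 1 to all natural numbers. *)
Definition oprod (gT : finGroupType) n (F : 'I_n -> gT) (i : nat) : gT :=
  if insub i is Some j then F j else 1%g.

Lemma oprodE (gT : finGroupType) n (F : 'I_n -> gT) (i : 'I_n) : oprod F i = F i.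
Proof. by rewrite /oprod valK. Qed.

Lemma prod_nat (gT : finGroupType) n (F : 'I_n -> gT) :
  (\prod_(i < n) F i = \prod_(0 <= i < n) oprod F i)%g.
Proof. by rewrite big_mkord; apply: eq_bigr => i _; rewrite oprodE. Qed.

Lemma prod_hue_overlay m n (t : {ffun 'I_n -> option bool})
    (s : {ffun 'I_m -> option bool}) : m <= n ->
  (\prod_(i < n) hue (overlay t s i) =
   \prod_(i < m) hue (s i) * \prod_(m <= i < n) oprod (hue \o t) i)%g.
Proof.
move=> le_mn; rewrite !prod_nat [LHS](@big_cat_nat _ _ _ m) //=; congr (_ * _)%g.
  apply: eq_big_nat => i /andP[_ im]; rewrite /oprod !insubT ?(leq_trans im) //.
  by move=> lt_in; rewrite ffunE /= insubT.
apply: eq_big_nat => i /andP[mi lt_in]; rewrite /oprod insubT /=.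
by rewrite overlay_tail.
Qed.

Lemma tangle_pad m n (le_mn : m <= n) (E : strings m) :
  tangle E -> tangle (pad le_mn E).
Proof.
move=> [Em Ep]; split=> [|t b]; first exact: pad_matching.
rewrite compat_pad => /andP[/Ep Et tb].
have tt : same_tail m t t by apply/same_tailP.
rewrite -(overlay_restr le_mn tb) -{1}(overlay_restr le_mn tt).
by rewrite !prod_hue_overlay // Et.
Qed.

Lemma tangle_close k (E : strings k.+1) : tangle E -> tangle (close_last E).
Proof.
move=> [Em Ep]; split=> [|t b tb]; first exact: close_matching.
have := card_close None Em t b; rewrite tb mul1n => h.
set P := [pred c | _] in h; have /card_gt0P[c] : 0 < #|P|.
  by rewrite h expn_gt0 card_option.
rewrite inE => /Ep; rewrite !prod_hue_overlay //; apply: mulIg.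
Qed.

Lemma tangle_one n : tangle (diag n nostring nostring eq_op).
Proof. by split=> [|t b]; [exact: one_matching|rewrite compat_one => /eqP->]. Qed.

Lemma tangle_p n i :
  tangle (diag n nostring nostring (fun s t => (s == t) && (s != i))).
Proof.
by split=> [|t b]; [exact: p_matching|rewrite compat_p => /andP[_ /eqP->]].
Qed.

(** Products that differ only at two adjacent places. *)
Lemma prod_adjacent (gT : finGroupType) n (a a' : 'I_n) (F G : 'I_n -> gT) :
    a' = a.+1 :> nat -> (forall s, s != a -> s != a' -> F s = G s) ->
    (F a * F a' = G a * G a')%g ->
  (\prod_(i < n) F i = \prod_(i < n) G i)%g.
Proof.
move=> a'E FG FGa; rewrite !prod_nat.
have split_at H : (\prod_(0 <= i < n) oprod H i = \prod_(0 <= i < a) oprod H i *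
    ((H a : gT) * H a' * \prod_(a.+2 <= i < n) oprod H i))%g.
  have a2 : a.+1 < n by rewrite -a'E.
  rewrite (@big_cat_nat _ _ _ a) ?(ltnW (ltnW a2)) //=.
  by rewrite (big_ltn (ltnW a2)) (big_ltn a2) -a'E !oprodE -mulgA.
rewrite !split_at FGa; congr (_ * (_ * _))%g; apply: eq_big_nat => i ia;
  rewrite /oprod; case: insubP => // j _ jE; apply: FG; rewrite -val_eqE /= jE; lia.
Qed.

Lemma tangle_l n (a a' : 'I_n) : a' = a.+1 :> nat -> tangle (l_strings n a.+1).
Proof.
move=> a'E; split=> [|t b]; first exact: l_matching.
rewrite (compat_l _ a'E) => /andP[/eqP ta /eqP->].
apply: (prod_adjacent a'E) => [s nsa nsa'|]; rewrite !ffunE.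
  by rewrite tpermD // eq_sym.
by rewrite tpermL tpermR ta mulg1 mul1g.
Qed.

Lemma tangle_e n (a a' : 'I_n) : a' = a.+1 :> nat ->
  tangle (diag n (cap a.+1) (cap a.+1) (vertical_off a.+1)).
Proof.
move=> a'E; split=> [|t b]; first exact: e_matching.
rewrite (compat_e _ a'E) => /and3P[/eqP ta /eqP ba /forallP tb].
apply: (prod_adjacent a'E) => [s nsa nsa'|]; last by rewrite ta ba !hueV.
by have := tb s; rewrite nsa nsa' => /eqP->.
Qed.

(** * Identities between diagrams *)

(** The 0-1 matrix of a diagram, for colorings with two colors. *)
Definition weight n (E : strings n) (t b : {ffun 'I_n -> bool}) : nat :=
  compat false E t b.

(** A diagram, together with a power of two, is determined by its matrix. *)
Lemma weight_inj n (x y : strings n) c c' :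
    matching (joined x) -> matching (joined y) ->
    (forall t b, weight x t b * 2 ^ c = weight y t b * 2 ^ c') ->
  x = y /\ c = c'.
Proof.
move=> xm ym h; have ce : c = c'.
  have := h [ffun=> false] [ffun=> false]; rewrite /weight !compat_const !mul1n.
  by move/eqP; rewrite eqn_exp2l // => /eqP.
split=> //; apply: compat_inj => // t b; have := h t b; rewrite ce => /eqP.
rewrite eqn_pmul2r ?expn_gt0 // /weight.
by case: (compat _ _ t b) (compat _ _ t b) => [] [].
Qed.

Lemma sum_stack n (x y : strings n) t b :
    matching (joined x) -> matching (joined y) ->
  \sum_m weight x t m * weight y m b = weight (stack x y) t b * 2 ^ kappa x y.
Proof.
move=> xm ym; rewrite -card_bool /weight -card_middle // -sum1_card [RHS]big_mkcond /=.
by apply: eq_bigr => m _; rewrite inE mulnb; case: (_ && _).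
Qed.

Lemma sum_close k (E : strings k.+1) (t b : {ffun 'I_k -> bool}) :
    matching (joined E) ->
  \sum_(c : bool) weight E (overlay [ffun=> c] t) (overlay [ffun=> c] b) =
  weight (close_last E) t b * 2 ^ close_loops E.
Proof.
move=> Em; rewrite -card_bool /weight -card_close // -sum1_card [RHS]big_mkcond /=.
by apply: eq_bigr => c _; rewrite inE /weight; case: (compat _ _ _ _).
Qed.

Lemma sum_pad m n (le_mn : m <= n) (E : strings m) t (F : {ffun 'I_n -> bool} -> nat) :
  \sum_s weight (pad le_mn E) t s * F s =
  \sum_s weight E (restr le_mn t) s * F (overlay t s).
Proof.
rewrite (bigID (same_tail m t)) /= addnC big1 ?add0n; last first.
  by move=> s ts; rewrite /weight compat_pad (negPf ts) andbF mul0n.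
rewrite (reindex_onto (overlay t) (restr le_mn)) /=; last first.
  by move=> s; exact: overlay_restr.
apply: eq_big => [s|s _]; first by rewrite overlayK eqxx same_tail_sym same_tail_overlay.
by rewrite /weight compat_pad overlayK same_tail_sym same_tail_overlay andbT.
Qed.

(** Collapsing a sum whose middle coloring is determined. *)
Lemma sum_delta n (P : bool) (s : {ffun 'I_n -> bool})
    (F : {ffun 'I_n -> bool} -> nat) :
  \sum_m (P && (m == s)) * F m = P * F s.
Proof.
rewrite (bigD1 s) //= eqxx andbT big1 ?addn0 // => m /negPf->.
by rewrite andbF mul0n.
Qed.

Lemma weight_reflect n (E : strings n) t b :
  weight (reflect_strings E) t b = weight E b t.
Proof. by rewrite /weight compat_reflect. Qed.

Lemma weight_one n (t b : {ffun 'I_n -> bool}) :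
  weight (diag n nostring nostring eq_op) t b = (true && (b == t)).
Proof. by rewrite /weight compat_one eq_sym. Qed.

Lemma weight_p n i (t b : {ffun 'I_n -> bool}) :
  weight (diag n nostring nostring (fun s t => (s == t) && (s != i))) t b =
  (trivial_at false i t && (b == t)).
Proof. by rewrite /weight compat_p eq_sym. Qed.

Lemma trivial_at_ord n (a : 'I_n) (t : {ffun 'I_n -> bool}) :
  trivial_at false a.+1 t = (t a == false).
Proof.
apply/forallP/idP => [/(_ a)|ta s]; first by rewrite eqxx.
by apply/implyP=> /eqP[/ord_inj->].
Qed.

Lemma weight_l n (a a' : 'I_n) (t b : {ffun 'I_n -> bool}) : a' = a.+1 :> nat ->
  weight (l_strings n a.+1) t b = ((t a' == false) && (b == swap a a' t)).
Proof. by move=> a'E; rewrite /weight (compat_l _ a'E). Qed.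

Lemma weight_r n (a a' : 'I_n) (t b : {ffun 'I_n -> bool}) : a' = a.+1 :> nat ->
  weight (reflect_strings (l_strings n a.+1)) t b =
  ((t a == false) && (b == swap a a' t)).
Proof.
move=> a'E; rewrite weight_reflect (weight_l _ _ a'E).
have -> : (b == swap a a' t) = (t == swap a a' b).
  by apply/eqP/eqP => ->; rewrite swapK.
by case: (t =P _) => [->|_]; rewrite ?andbF // ffunE tpermL.
Qed.

(** ** Stacking *)

Lemma stack_assoc n (x y z : strings n) :
    matching (joined x) -> matching (joined y) -> matching (joined z) ->
  stack (stack x y) z = stack x (stack y z) /\
  kappa x y + kappa (stack x y) z = kappa y z + kappa x (stack y z).
Proof.
move=> xm ym zm.
have xym := stack_matching xm ym; have yzm := stack_matching ym zm.
apply: weight_inj => [||t b]; [exact: stack_matching..|].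
rewrite [kappa x y + _]addnC [kappa y z + _]addnC !expnD !mulnA.
rewrite -(sum_stack _ _ xym zm) -(sum_stack _ _ xm yzm) !big_distrl /=.
under eq_bigr => m _ do rewrite mulnAC -(sum_stack _ _ xm ym) big_distrl /=.
under [RHS]eq_bigr => m _ do rewrite -mulnA -(sum_stack _ _ ym zm) big_distrr /=.
rewrite exchange_big; apply: eq_bigr => m _; apply: eq_bigr => m' _.
by rewrite mulnA.
Qed.

Lemma stack_1x n (x : strings n) : matching (joined x) ->
  stack (diag n nostring nostring eq_op) x = x /\
  kappa (diag n nostring nostring eq_op) x = 0.
Proof.
move=> xm; have om := one_matching n.
apply: weight_inj => // [|t b]; first exact: stack_matching.
rewrite -(sum_stack _ _ om xm) muln1; under eq_bigr => m _ do rewrite weight_one.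
by rewrite sum_delta mul1n.
Qed.

Lemma stack_x1 n (x : strings n) : matching (joined x) ->
  stack x (diag n nostring nostring eq_op) = x /\
  kappa x (diag n nostring nostring eq_op) = 0.
Proof.
move=> xm; have om := one_matching n.
apply: weight_inj => // [|t b]; first exact: stack_matching.
rewrite -(sum_stack _ _ xm om) muln1.
under eq_bigr => m _ do rewrite mulnC weight_one eq_sym.
by rewrite sum_delta mul1n.
Qed.

Lemma stack_px n i (x : strings n) t b : matching (joined x) ->
  let p := diag n nostring nostring (fun s t => (s == t) && (s != i)) in
  weight (stack p x) t b * 2 ^ kappa p x = trivial_at false i t * weight x t b.
Proof.
move=> xm p; rewrite -sum_stack //; last exact: p_matching.
by under eq_bigr => m _ do rewrite weight_p; rewrite sum_delta.
Qed.

Lemma stack_reflect n (x y : strings n) :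
    matching (joined x) -> matching (joined y) ->
  stack (reflect_strings y) (reflect_strings x) = reflect_strings (stack x y) /\
  kappa (reflect_strings y) (reflect_strings x) = kappa x y.
Proof.
move=> xm ym; have xr := reflect_matching xm; have yr := reflect_matching ym.
apply: weight_inj => [||t b]; first exact: stack_matching.
  exact/reflect_matching/stack_matching.
rewrite weight_reflect -(sum_stack _ _ xm ym) -(sum_stack _ _ yr xr); apply: eq_bigr => m _.
by rewrite !weight_reflect mulnC.
Qed.

Lemma reflectK n : involutive (@reflect_strings n).
Proof.
move=> E; apply/setP=> -[u v].
by rewrite -![_ \in _]/(joined _ u v) !joined_reflect !mirrorK.
Qed.

Lemma reflect_one n :
  reflect_strings (diag n nostring nostring eq_op) = diag n nostring nostring eq_op.
Proof.
by apply/setP=> -[[i|i] [j|j]]; rewrite -[LHS]/(joined _ _ _) joined_reflect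
  /joined !inE //= eq_sym.
Qed.

Lemma reflect_p n i :
  let p := diag n nostring nostring (fun s t => (s == t) && (s != i)) in
  reflect_strings p = p.
Proof.
by apply/setP=> -[[j|j] [k|k]]; rewrite -[LHS]/(joined _ _ _) joined_reflect
  /joined !inE //=; case: eqVneq => [->|]; rewrite ?eqxx // eq_sym => /negPf->.
Qed.

Lemma reflect_e n i :
  let e := diag n (cap i) (cap i) (vertical_off i) in reflect_strings e = e.
Proof.
by apply/setP=> -[[j|j] [k|k]]; rewrite -[LHS]/(joined _ _ _) joined_reflect
  /joined !inE //= /vertical_off; case: eqVneq => [->|]; rewrite ?eqxx // eq_sym
  => /negPf->.
Qed.

(** ** Padding *)

Lemma pad_stack m n (le_mn : m <= n) (x y : strings m) :
    matching (joined x) -> matching (joined y) ->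
  stack (pad le_mn x) (pad le_mn y) = pad le_mn (stack x y) /\
  kappa (pad le_mn x) (pad le_mn y) = kappa x y.
Proof.
move=> xm ym; have xp := pad_matching le_mn xm; have yp := pad_matching le_mn ym.
apply: weight_inj => [||t b]; first exact: stack_matching.
  exact/pad_matching/stack_matching.
rewrite -(sum_stack _ _ xp yp) sum_pad [in RHS]/weight compat_pad -mulnb -mulnA.
rewrite [_ * 2 ^ _]mulnC mulnA -[compat _ _ _ _ : nat]/(weight _ _ _) -(sum_stack _ _ xm ym).
rewrite big_distrl; apply: eq_bigr => s _; rewrite /= -mulnA; congr (_ * _).
rewrite [LHS]/weight compat_pad overlayK -mulnb; congr (_ * _); congr (nat_of_bool _).
apply/same_tailP/same_tailP => h i mi; first by rewrite -h ?overlay_tail.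
by rewrite overlay_tail // h.
Qed.

Lemma pad_pad l m n (le_lm : l <= m) (le_mn : m <= n) (le_ln : l <= n)
    (x : strings l) : matching (joined x) ->
  pad le_mn (pad le_lm x) = pad le_ln x.
Proof.
move=> xm; have xp := pad_matching le_lm xm.
apply: (@compat_inj n); [exact: pad_matching..|] => t b; rewrite !compat_pad.
have rr (s : {ffun 'I_n -> bool}) : restr le_lm (restr le_mn s) = restr le_ln s.
  by apply/ffunP=> i; rewrite !ffunE; congr (s _); apply: val_inj.
rewrite !rr -andbA; congr (_ && _); apply/andP/same_tailP.
  case=> /same_tailP h1 /same_tailP h2 i li; case: (ltnP i m) => [im|]; last exact: h2.
  have := h1 (Ordinal im) li; rewrite !ffunE.
  by congr (t _ = b _); apply: val_inj.
move=> h; split; apply/same_tailP=> i li; first by rewrite !ffunE h.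
by apply: h; apply: leq_trans li.
Qed.

Lemma pad_refl n (le_nn : n <= n) (x : strings n) : matching (joined x) ->
  pad le_nn x = x.
Proof.
move=> xm; apply: compat_inj => // [|t b]; first exact: pad_matching.
have rr (s : {ffun 'I_n -> bool}) : restr le_nn s = s.
  by apply/ffunP=> i; rewrite !ffunE; congr (s _); apply: val_inj.
rewrite compat_pad !rr (_ : same_tail _ _ _) ?andbT //.
by apply/same_tailP=> i; rewrite leqNgt ltn_ord.
Qed.

Lemma pad_diag m n (le_mn : m <= n) (tt bb tb : rel nat) :
    (forall i j, m < i \/ m < j -> tt i j = false) ->
    (forall i j, m < i \/ m < j -> bb i j = false) ->
    (forall i j, m < i \/ m < j -> tb i j = (i == j)) ->
  pad le_mn (diag m tt bb tb) = diag n tt bb tb.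
Proof.
move=> h1 h2 h3; apply/setP=> -[u v]; apply/idP/idP.
  case/joined_pad=> [[u' [v' [-> ->]]]|[i [mi [[-> ->]|[-> ->]]]]].
  - by rewrite /joined !inE; case: u' v' => i [].
  - by rewrite inE h3 ?eqxx //; left.
  by rewrite inE h3 ?eqxx //; left.
rewrite inE => uv; apply/joined_pad.
have low w : {w' | w = widen_point le_mn w'} +
    {m <= (match w with inl i | inr i => i end : 'I_n)}.
  case: w => i; case: (ltnP i m) => im; [left|by right|left|by right].
    by exists (inl (Ordinal im)); congr inl; apply: val_inj.
  by exists (inr (Ordinal im)); congr inr; apply: val_inj.
case: (low u) uv => [[u' ->]|mu].
  case: (low v) => [[v' ->] uv|mv].
    by left; exists u', v'; rewrite /joined inE; case: u' v' uv => i [].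
  case: u' v mv => i [] j mj /=.
  - by rewrite h1 //; right.
  - by rewrite h3; [move=> /eqP[/= ij]; move: mj; rewrite -ij leqNgt ltn_ord|right].
  - by rewrite h3; [move=> /eqP[/= ij]; move: mj; rewrite ij leqNgt ltn_ord|left].
  by rewrite h2 //; right.
case: u v mu => i [] j mi /=.
- by rewrite h1 //; left.
- by rewrite h3; [move=> /eqP[/ord_inj <-]; right; exists i; auto|left].
- by rewrite h3; [move=> /eqP[/ord_inj ->]; right; exists i; auto|right].
by rewrite h2 //; left.
Qed.

Lemma pad_one m n (le_mn : m <= n) :
  pad le_mn (diag m nostring nostring eq_op) = diag n nostring nostring eq_op.
Proof. exact: pad_diag. Qed.

Lemma pad_p m n (le_mn : m <= n) i : i <= m ->
  pad le_mn (diag m nostring nostring (fun s t => (s == t) && (s != i))) =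
  diag n nostring nostring (fun s t => (s == t) && (s != i)).
Proof. by move=> im; apply: pad_diag => // s t st /=; lia. Qed.

Lemma pad_e m n (le_mn : m <= n) i : i < m ->
  pad le_mn (diag m (cap i) (cap i) (vertical_off i)) =
  diag n (cap i) (cap i) (vertical_off i).
Proof.
by move=> im; apply: pad_diag => // s t st /=; rewrite /cap /vertical_off; lia.
Qed.

Lemma pad_reflect m n (le_mn : m <= n) (x : strings m) :
  reflect_strings (pad le_mn x) = pad le_mn (reflect_strings x).
Proof.
apply/setP=> -[u v]; rewrite -![_ \in _]/(joined _ u v) joined_reflect.
have mw w : mirror (widen_point le_mn w) = widen_point le_mn (mirror w) by case: w.
apply/idP/idP => /joined_pad h; apply/joined_pad.
  case: h => [[u' [v' [uE vE uv]]]|[i [mi uv]]]; [left|right].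
    exists (mirror u'), (mirror v').
    by rewrite -!mw -uE -vE joined_reflect !mirrorK.
  exists i; split=> //; rewrite -[u]mirrorK -[v]mirrorK.
  by case: uv => -[-> ->]; auto.
case: h => [[u' [v' [-> -> uv]]]|[i [mi [[-> ->]|[-> ->]]]]].
- by left; exists (mirror u'), (mirror v'); rewrite !mw -joined_reflect.
- by right; exists i; auto.
by right; exists i; auto.
Qed.

(** ** Products of generators *)

Lemma stack_rl n (a a' : 'I_n) : a' = a.+1 :> nat ->
  let l := l_strings n a.+1 in
  stack (reflect_strings l) l =
    diag n nostring nostring (fun s t => (s == t) && (s != a.+1)) /\
  kappa (reflect_strings l) l = 0.
Proof.
move=> a'E l; have lm : matching (joined l) by exact: l_matching.
have rm := reflect_matching lm.
apply: weight_inj => [||t b]; [exact: stack_matching|exact: p_matching|].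
rewrite -(sum_stack _ _ rm lm) muln1; under eq_bigr => m _ do rewrite (weight_r _ _ a'E).
rewrite sum_delta (weight_l _ _ a'E) swapK weight_p trivial_at_ord ffunE tpermR.
by case: (t a); rewrite // mul1n.
Qed.

Lemma stack_lr n (a a' : 'I_n) : a' = a.+1 :> nat ->
  let l := l_strings n a.+1 in
  stack l (reflect_strings l) =
    diag n nostring nostring (fun s t => (s == t) && (s != a'.+1)) /\
  kappa l (reflect_strings l) = 0.
Proof.
move=> a'E l; have lm : matching (joined l) by exact: l_matching.
have rm := reflect_matching lm.
apply: weight_inj => [||t b]; [exact: stack_matching|exact: p_matching|].
rewrite -(sum_stack _ _ lm rm) muln1; under eq_bigr => m _ do rewrite (weight_l _ _ a'E).
rewrite sum_delta (weight_r _ _ a'E) swapK weight_p trivial_at_ord ffunE tpermL.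
by case: (t a'); rewrite // mul1n.
Qed.

Lemma stack_pl n (a a' : 'I_n) : a' = a.+1 :> nat ->
  let l := l_strings n a.+1 in
  let p := diag n nostring nostring (fun s t => (s == t) && (s != a'.+1)) in
  stack p l = l /\ kappa p l = 0.
Proof.
move=> a'E l p; have lm : matching (joined l) by exact: l_matching.
have pm : matching (joined p) by exact: p_matching.
apply: weight_inj => // [|t b]; first exact: stack_matching.
by rewrite (stack_px _ _ _ lm) muln1 (weight_l _ _ a'E) trivial_at_ord; case: (t a'); rewrite // mul1n.
Qed.

Lemma stack_pr n (a a' : 'I_n) : a' = a.+1 :> nat ->
  let r := reflect_strings (l_strings n a.+1) in
  let p := diag n nostring nostring (fun s t => (s == t) && (s != a.+1)) in
  stack p r = r /\ kappa p r = 0.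
Proof.
move=> a'E r p.
have rm : matching (joined r) by exact/reflect_matching/l_matching.
have pm : matching (joined p) by exact: p_matching.
apply: weight_inj => // [|t b]; first exact: stack_matching.
by rewrite (stack_px _ _ _ rm) muln1 (weight_r _ _ a'E) trivial_at_ord; case: (t a); rewrite // mul1n.
Qed.

Lemma stack_pp n i :
  let p := diag n nostring nostring (fun s t => (s == t) && (s != i)) in
  stack p p = p /\ kappa p p = 0.
Proof.
move=> p; have pm : matching (joined p) by exact: p_matching.
apply: weight_inj => // [|t b]; first exact: stack_matching.
by rewrite (stack_px _ _ _ pm) muln1 weight_p; case: (trivial_at _ _ _); rewrite // mul1n.
Qed.

(** Killing either end of a cap is the same. *)
Lemma stack_pe n (a a' : 'I_n) : a' = a.+1 :> nat ->
  let e := diag n (cap a.+1) (cap a.+1) (vertical_off a.+1) in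
  let p i := diag n nostring nostring (fun s t => (s == t) && (s != i)) in
  stack (p a'.+1) e = stack (p a.+1) e /\ kappa (p a'.+1) e = kappa (p a.+1) e.
Proof.
move=> a'E e p; have em : matching (joined e) by exact: e_matching.
have pm i : matching (joined (p i)) by exact: p_matching.
apply: weight_inj => [||t b]; [exact: stack_matching..|].
rewrite !(stack_px _ _ _ em) !trivial_at_ord /weight (compat_e _ a'E).
by case: (eqVneq (t a) (t a')) => [->|]; rewrite ?muln0.
Qed.

(** A diagram on the first [k] strings commutes with killing the next one. *)
Lemma stack_p_pad k (x : strings k) : matching (joined x) ->
  let p := diag k.+1 nostring nostring (fun s t => (s == t) && (s != k.+1)) in
  let y := pad (leqnSn k) x in
  stack p y = stack y p /\ kappa p y = kappa y p.
Proof.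
move=> xm p y; have pm : matching (joined p) by exact: p_matching.
have ym : matching (joined y) by exact: pad_matching.
apply: weight_inj => [||t b]; [exact: stack_matching..|].
rewrite (stack_px _ _ _ ym) -(sum_stack _ _ ym pm).
have pb (m : {ffun 'I_k.+1 -> bool}) :
    trivial_at false k.+1 m && (b == m) = trivial_at false k.+1 b && (m == b).
  by rewrite eq_sym; case: (m =P b) => [->|_]; rewrite ?andbF.
under eq_bigr => m _ do rewrite weight_p pb mulnC.
rewrite sum_delta /weight /y compat_pad.
case: (boolP (same_tail k t b)) => [/same_tailP tb|]; last by rewrite andbF !muln0.
rewrite (@trivial_at_ord _ ord_max) (@trivial_at_ord _ ord_max) tb //.
Qed.

(** ** Closing up *)

Lemma close_pad_stack k (x : strings k) (y : strings k.+1) :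
    matching (joined x) -> matching (joined y) ->
  let z := stack (pad (leqnSn k) x) y in
  close_last z = stack x (close_last y) /\
  close_loops z + kappa (pad (leqnSn k) x) y =
    kappa x (close_last y) + close_loops y.
Proof.
move=> xm ym z; have xp := pad_matching (leqnSn k) xm.
have zm : matching (joined z) by exact: stack_matching.
have ycm := close_matching ym.
apply: weight_inj => [||t b]; [exact: close_matching|exact: stack_matching|].
rewrite !expnD !mulnA -(sum_close _ _ zm) -(sum_stack _ _ xm ycm) !big_distrl /=.
under eq_bigr => c _ do rewrite -(sum_stack _ _ xp ym) sum_pad.
under [RHS]eq_bigr => m _ do rewrite -mulnA -(sum_close _ _ ym) big_distrr /=.
rewrite exchange_big; apply: eq_bigr => m _; apply: eq_bigr => c _.
have -> : overlay (overlay [ffun=> c] t) m = overlay [ffun=> c] m :> {ffun 'I_k.+1 -> bool}.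
  by apply/ffunP=> i; rewrite !ffunE; case: insub => // j; rewrite !ffunE.
by rewrite (overlayK (leqnSn k)).
Qed.

Lemma close_reflect k (x : strings k.+1) : matching (joined x) ->
  close_last (reflect_strings x) = reflect_strings (close_last x) /\
  close_loops (reflect_strings x) = close_loops x.
Proof.
move=> xm; have xr := reflect_matching xm.
apply: weight_inj => [||t b]; first exact: close_matching.
  exact/reflect_matching/close_matching.
rewrite weight_reflect -(sum_close _ _ xr) -(sum_close _ _ xm).
by apply: eq_bigr => c _; rewrite weight_reflect.
Qed.

Lemma overlay_eq k c (t b : {ffun 'I_k -> bool}) :
  (overlay [ffun=> c] t == overlay [ffun=> c] b :> {ffun 'I_k.+1 -> bool}) = (t == b).
Proof. by rewrite (can_eq (overlayK (leqnSn k) _)). Qed.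

Lemma overlay_last k c (t : {ffun 'I_k -> bool}) :
  (overlay [ffun=> c] t : {ffun 'I_k.+1 -> bool}) ord_max = c.
Proof. by rewrite overlay_tail // ffunE. Qed.

Lemma close_one k :
  close_last (diag k.+1 nostring nostring eq_op) = diag k nostring nostring eq_op /\
  close_loops (diag k.+1 nostring nostring eq_op) = 1.
Proof.
have om := one_matching k.+1.
apply: weight_inj => [||t b]; [exact: close_matching|exact: one_matching|].
by rewrite -(sum_close _ _ om) big_bool /= !weight_one !overlay_eq; case: (b == t).
Qed.

Lemma close_p k :
  let p := diag k.+1 nostring nostring (fun s t => (s == t) && (s != k.+1)) in
  close_last p = diag k nostring nostring eq_op /\ close_loops p = 0.
Proof.
have pm := p_matching k.+1 k.+1.
apply: weight_inj => [||t b]; [exact: close_matching|exact: one_matching|].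
rewrite -(sum_close _ _ pm) big_bool /= !weight_p weight_one !overlay_eq.
by rewrite !(@trivial_at_ord _ ord_max) !overlay_last; case: (b == t).
Qed.

Lemma close_e k :
  let e := diag k.+2 (cap k.+1) (cap k.+1) (vertical_off k.+1) in
  close_last e = diag k.+1 nostring nostring eq_op /\ close_loops e = 0.
Proof.
move=> e; have em : matching (joined e) by exact: e_matching.
apply: weight_inj => [||t b]; [exact: close_matching|exact: one_matching|].
pose a : 'I_k.+2 := widen_ord (leqnSn _) (ord_max : 'I_k.+1).
have aE : (ord_max : 'I_k.+2) = a.+1 :> nat by [].
rewrite -(sum_close _ _ em) muln1 weight_one /weight.
have eE c : compat false e (overlay [ffun=> c] t) (overlay [ffun=> c] b) =
    (t ord_max == c) && (t == b).
  rewrite (compat_e _ aE) !overlay_last !overlay_widen.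
  apply/and3P/andP => [[/eqP tc /eqP bc /forallP tb]|[/eqP tc /eqP <-]].
    split; first exact/eqP.
    apply/eqP/ffunP=> s; have := tb (widen_ord (leqnSn _) s).
    rewrite !overlay_widen -!val_eqE /= [X in _ && X]neq_ltn ltn_ord andbT.
    case: eqP => [sa _|_ /eqP //].
    by have -> : s = ord_max by [apply: val_inj]; rewrite tc bc.
  split; rewrite ?tc //; apply/forallP=> s.
  by rewrite eqxx implybT.
by rewrite big_bool /= !eE [b == t]eq_sym; case: (t ord_max) (t == b) => [] [].
Qed.

(** Between two caps, the last string of [x] is closed up. *)
Lemma stack_e_pad_e k (x : strings k.+1) : matching (joined x) ->
  let e := diag k.+2 (cap k.+1) (cap k.+1) (vertical_off k.+1) in
  let y := pad (leqnSn k.+1) x in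
  let z := pad (leqnSn k.+1) (pad (leqnSn k) (close_last x)) in
  stack (stack e y) e = stack z e /\
  kappa (stack e y) e + kappa e y = kappa z e + close_loops x.
Proof.
move=> xm e y z; have em : matching (joined e) by exact: e_matching.
have ym : matching (joined y) by exact: pad_matching.
have cm := close_matching xm; have cpm := pad_matching (leqnSn k) cm.
have zm : matching (joined z) by exact: pad_matching.
have eym : matching (joined (stack e y)) by exact: stack_matching.
apply: weight_inj => [||t b]; [exact: stack_matching..|].
pose a : 'I_k.+2 := widen_ord (leqnSn _) (ord_max : 'I_k.+1).
have aE : (ord_max : 'I_k.+2) = a.+1 :> nat by [].
pose res (s : {ffun 'I_k.+2 -> bool}) : {ffun 'I_k -> bool} :=
  restr (leqnSn k) (restr (leqnSn k.+1) s).
pose fill c (s : {ffun 'I_k -> bool}) : {ffun 'I_k.+2 -> bool} :=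
  overlay [ffun=> c] (overlay [ffun=> c] s : {ffun 'I_k.+1 -> bool}).
pose flat (s : {ffun 'I_k.+2 -> bool}) := s a == s ord_max.
have res_fill c s : res (fill c s) = s by rewrite /res /fill !overlayK.
have flat_fill c s : flat (fill c s).
  by rewrite /flat /fill overlay_widen !overlay_last.
have fill_res c s : flat s -> s a = c -> fill c (res s) = s.
  move=> /eqP sf sc; apply/ffunP=> i; have [->|ni] := eqVneq i ord_max.
    by rewrite overlay_last -sc sf.
  have lt_i : i < k.+1 by move: ni; rewrite -val_eqE /=; have := ltn_ord i; lia.
  have -> : i = widen_ord (leqnSn k.+1) (Ordinal lt_i) by apply: val_inj.
  rewrite overlay_widen; have [->|nj] := eqVneq (Ordinal lt_i) ord_max.
    by rewrite overlay_last -sc.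
  have lt_j : Ordinal lt_i < k by move: nj; rewrite -val_eqE /=; lia.
  have -> : Ordinal lt_i = widen_ord (leqnSn k) (Ordinal lt_j) by apply: val_inj.
  by rewrite overlay_widen !ffunE.
have weE s s' : weight e s s' = flat s && flat s' && (res s == res s').
  rewrite /weight (compat_e _ aE) -andbA; congr (nat_of_bool [&& _, _ & _]).
  apply/forallP/eqP => [h|h i].
    apply/ffunP=> i; rewrite !ffunE; apply/eqP.
    have := h (widen_ord (leqnSn k.+1) (widen_ord (leqnSn k) i)).
    by rewrite -!val_eqE /= (ltn_eqF (ltn_ord i)) (ltn_eqF (leqW (ltn_ord i))).
  apply/implyP=> /andP[nia nim].
  have lt_i : i < k by move: nia nim; rewrite -!val_eqE /=; have := ltn_ord i; lia.
  have /eqP := congr1 (fun f : {ffun 'I_k -> bool} => f (Ordinal lt_i)) h.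
  rewrite !ffunE.
  by rewrite (_ : widen_ord _ _ = i) //; apply: val_inj.
(* A coloring below the cap is given by the common color of its last two
   points. *)
have sum_e s (G : {ffun 'I_k.+2 -> bool} -> nat) :
    \sum_m weight e s m * G m = flat s * \sum_c G (fill c (res s)).
  rewrite (bigID (fun m => flat m && (res m == res s))) /= [X in _ + X]big1 ?addn0; last first.
    by move=> m; rewrite weE -andbA [res s == _]eq_sym => /negPf->; rewrite andbF.
  rewrite (reindex_onto (fun c => fill c (res s)) (fun m => m a)) /=; last first.
    by move=> m /andP[mf /eqP <-]; apply: fill_res.
  rewrite big_distrr; apply: eq_big => [c|c _] /=.
    rewrite flat_fill res_fill eqxx /= /fill overlay_widen overlay_last.
    by rewrite eqxx.
  by rewrite weE flat_fill res_fill eqxx !andbT.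
have sum_fill s s' : \sum_c (s' == fill c s) = flat s' && (res s' == s).
  case: (boolP (flat s')) => sf; last first.
    rewrite big1 // => c _; case: eqP => // s'E.
    by move: sf; rewrite s'E flat_fill.
  rewrite (bigD1 (s' a)) //= big1 ?addn0 => [|c nc].
    congr (nat_of_bool _); apply/eqP/eqP => [->|<-]; first by rewrite res_fill.
    by rewrite fill_res.
  case: eqP => // s'E; move: nc; rewrite s'E /fill overlay_widen overlay_last.
  by rewrite eqxx.
rewrite !expnD !mulnA -(sum_stack _ _ eym em) -(sum_stack _ _ zm em).
rewrite !big_distrl /=.
under eq_bigr => m _ do rewrite mulnAC -(sum_stack _ _ em ym) sum_e big_distrr /=
  big_distrl /=.
rewrite exchange_big /=.
have weC m : weight e m b = weight e b m.
  by rewrite !weE [flat m && _]andbC [res m == _]eq_sym.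
have wyE c c' u v : weight y (fill c u) (fill c' v) =
    (c' == c) * weight x (overlay [ffun=> c] u) (overlay [ffun=> c'] v).
  rewrite /weight compat_pad !overlayK mulnC mulnb; congr (nat_of_bool (_ && _)).
  apply/same_tailP/eqP => [/(_ ord_max)|->].
    by rewrite !overlay_last => ->.
  by move=> i ki; rewrite /fill !(overlay_tail _ _ ki).
under eq_bigr => c _.
  under eq_bigr => m _ do rewrite weC mulnC.
  rewrite sum_e; under eq_bigr => c' _ do rewrite wyE mulnCA.
  rewrite (bigD1 c) //= eqxx mul1n big1 ?addn0; last by move=> c' /negPf->.
  over.
rewrite -big_distrr -big_distrr /= (sum_close _ _ xm).
under eq_bigr => m _ do rewrite -mulnA.
rewrite !sum_pad.
have lift_flat (s : {ffun 'I_k -> bool}) :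
    flat (overlay t (overlay (restr (leqnSn k.+1) t) s)) = flat t.
  by rewrite /flat overlay_widen !overlay_tail // ffunE.
under eq_bigr => s _ do rewrite weE lift_flat {1}/res !overlayK mulnCA.
rewrite sum_delta -mulnb -mulnA mulnCA; congr (_ * _).
Qed.

(** * The Motzkin algebra *)

Local Open Scope ring_scope.
Local Open Scope motzkin_scope.

Section Algebra.

Variables (F : fieldType) (D : F).
Local Notation M := (motzkin_alg D).

Lemma tangle_val n (a : motzkin n) : tangle (val a).
Proof. exact/is_motzkinP/(valP a). Qed.

Lemma coef_add n (x y : M n) a : coef (x + y) a = coef x a + coef y a.
Proof. exact: ffunE. Qed.

Lemma coef_scale n c (x : M n) a : coef (c *: x) a = c * coef x a.
Proof. exact: ffunE. Qed.

Lemma coef_zero n a : coef (0 : M n) a = 0.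
Proof. exact: ffunE. Qed.

Lemma coef_basis n (E : strings n) a : coef (basis D E) a = (val a == E)%:R.
Proof. exact: ffunE. Qed.

Lemma coef_inj n (x y : M n) : coef x =1 coef y -> x = y.
Proof. by move=> xy; apply/ffunP=> a; exact: xy. Qed.

(** Linear extension from the basis of diagrams. *)
Definition extlin n (V : lmodType F) (phi : motzkin n -> V) (x : M n) : V :=
  \sum_a coef x a *: phi a.

Lemma extlin_is_linear n (V : lmodType F) (phi : motzkin n -> V) :
  linear (extlin phi).
Proof.
move=> c x y; rewrite /extlin scaler_sumr -big_split; apply: eq_bigr => a _ /=.
by rewrite coef_add coef_scale scalerDl scalerA.
Qed.

HB.instance Definition _ n (V : lmodType F) (phi : motzkin n -> V) :=
  GRing.isLinear.Build F (M n) V *:%R (extlin phi) (extlin_is_linear phi).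

Lemma extlin_basis n (V : lmodType F) (phi : motzkin n -> V) a :
  extlin phi (basis D (val a)) = phi a.
Proof.
rewrite /extlin (bigD1 a) //= coef_basis eqxx scale1r big1 ?addr0 // => b nab.
by rewrite coef_basis (inj_eq val_inj) (negPf nab) scale0r.
Qed.

Lemma tangle_exists n (E : strings n) : tangle E -> exists a : motzkin n, val a = E.
Proof. by move/is_motzkinP => Em; exists (Sub E Em); rewrite SubK. Qed.

Lemma basis_expansion n (x : M n) : x = extlin (fun a => basis D (val a)) x.
Proof.
apply: coef_inj => a; rewrite /extlin.
have coef_sum (I : finType) (f : I -> M n) :
    coef (\sum_i f i) a = \sum_i coef (f i) a.
  by apply: (big_morph (fun z : M n => coef z a)) => [y z|]; rewrite ?coef_add ?coef_zero.
rewrite coef_sum (bigD1 a) //= coef_scale coef_basis eqxx mulr1 big1 ?addr0 // => b nab.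
by rewrite coef_scale coef_basis (inj_eq val_inj) eq_sym (negPf nab) mulr0.
Qed.

Lemma mmulE n (x y : M n) : mmul x y =
  extlin (fun a => extlin (fun b =>
    D ^+ kappa (val a) (val b) *: basis D (stack (val a) (val b))) y) x.
Proof.
apply: eq_bigr => a _; rewrite scaler_sumr; apply: eq_bigr => b _.
by rewrite !scalerA.
Qed.

Lemma mmul_linear_l n (y : M n) : linear (fun x : M n => x ** y).
Proof. by move=> c x x'; rewrite !mmulE linearP. Qed.

Lemma mmul_linear_r n (x : M n) : linear (fun y : M n => x ** y).
Proof.
move=> c y y'; rewrite !mmulE /extlin scaler_sumr -big_split /=.
apply: eq_bigr => a _; rewrite -[\sum_b _]/(extlin _ _) linearP scalerDr.
by rewrite !scalerA [c * _]mulrC.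
Qed.

Lemma mul_basis n (E E' : strings n) : tangle E -> tangle E' ->
  basis D E ** basis D E' = D ^+ kappa E E' *: basis D (stack E E').
Proof.
move=> /tangle_exists[a <-] /tangle_exists[b <-].
by rewrite mmulE !extlin_basis.
Qed.

Lemma basis_ind n (P : M n -> Prop) :
    (forall E, tangle E -> P (basis D E)) -> P 0 ->
    (forall c x y, P x -> P y -> P (c *: x + y)) -> forall x, P x.
Proof.
move=> PE P0 Plin x; rewrite (basis_expansion x) /extlin.
apply: (big_rec P) => // a y _ Py; apply: Plin => //.
by apply: PE; exact: tangle_val.
Qed.

Lemma mul0m n (y : M n) : 0 ** y = 0.
Proof. by rewrite mmulE linear0. Qed.

Lemma mulm0 n (x : M n) : x ** 0 = 0.
Proof. by have := mmul_linear_r x (-1) 0 0; rewrite scaler0 addr0 scaleN1r addNr. Qed.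

Lemma mmulA n : associative (@mmul F D n).
Proof.
move=> x y z.
elim/basis_ind: x => [a aT||c x x' hx hx']; last 2 first.
- by rewrite !mul0m.
- by rewrite !mmul_linear_l hx hx'.
elim/basis_ind: y => [b bT||c y y' hy hy']; last 2 first.
- by rewrite mul0m mulm0 mul0m.
- by rewrite mmul_linear_l !mmul_linear_r mmul_linear_l hy hy'.
elim/basis_ind: z => [d dT||c z z' hz hz']; last 2 first.
- by rewrite !mulm0.
- by rewrite !mmul_linear_r hz hz'.
have scale_l k (u v : M n) : (k *: u) ** v = k *: (u ** v).
  by have := mmul_linear_l v k u 0; rewrite mul0m !addr0.
have scale_r k (u v : M n) : u ** (k *: v) = k *: (u ** v).
  by have := mmul_linear_r u k v 0; rewrite mulm0 !addr0.
have abT := tangle_stack aT bT; have bdT := tangle_stack bT dT.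
rewrite (mul_basis aT bT) (mul_basis bT dT) scale_l scale_r.
rewrite (mul_basis abT dT) (mul_basis aT bdT) !scalerA.
have [-> kE] := stack_assoc (proj1 aT) (proj1 bT) (proj1 dT).
by rewrite -!exprD kE.
Qed.

Lemma mul1m n : left_id mone (@mmul F D n).
Proof.
move=> x; elim/basis_ind: x => [a aT||c x y hx hy].
- rewrite mul_basis //; last exact: tangle_one.
  by have [-> ->] := stack_1x (proj1 aT); rewrite expr0 scale1r.
- exact: mulm0.
by rewrite mmul_linear_r hx hy.
Qed.

Lemma mulm1 n : right_id mone (@mmul F D n).
Proof.
move=> x; elim/basis_ind: x => [a aT||c x y hx hy].
- rewrite mul_basis //; last exact: tangle_one.
  by have [-> ->] := stack_x1 (proj1 aT); rewrite expr0 scale1r.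
- exact: mul0m.
by rewrite mmul_linear_l hx hy.
Qed.

Lemma mone_neq0 n : mone != 0 :> M n.
Proof.
have [a aE] := tangle_exists (tangle_one n).
apply/eqP=> /(congr1 (fun x : M n => coef x a)) /eqP.
by rewrite coef_basis coef_zero aE eqxx oner_eq0.
Qed.

Lemma mmulDl n : left_distributive (@mmul F D n) +%R.
Proof. by move=> x y z; have := mmul_linear_l z 1 x y; rewrite !scale1r. Qed.

Lemma mmulDr n : right_distributive (@mmul F D n) +%R.
Proof. by move=> x y z; have := mmul_linear_r x 1 y z; rewrite !scale1r. Qed.

HB.instance Definition _ n := GRing.Zmodule_isNzRing.Build (M n)
  (@mmulA n) (@mul1m n) (@mulm1 n) (@mmulDl n) (@mmulDr n) (mone_neq0 n).

Lemma mmulZl n c (x y : M n) : c *: (x * y) = (c *: x) * y.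
Proof. by have := mmul_linear_l y c x 0; rewrite mul0m !addr0. Qed.

Lemma mmulZr n c (x y : M n) : c *: (x * y) = x * (c *: y).
Proof. by have := mmul_linear_r x c y 0; rewrite mulm0 !addr0. Qed.

HB.instance Definition _ n := GRing.Lmodule_isLalgebra.Build F (M n) (@mmulZl n).
HB.instance Definition _ n := GRing.Lalgebra_isAlgebra.Build F (M n) (@mmulZr n).

End Algebra.

(** ** Inclusion, adjoint and conditional expectation *)

Section Maps.

Variables (F : fieldType) (D : F).
Local Notation M := (motzkin_alg D).

Lemma mul_basisE n (E E' : strings n) : tangle E -> tangle E' ->
  basis D E * basis D E' = D ^+ kappa E E' *: basis D (stack E E').
Proof. exact: mul_basis. Qed.

Lemma minc_linear m n (le_mn : (m <= n)%N) : linear (@minc F D m n le_mn).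
Proof. exact: extlin_is_linear. Qed.

HB.instance Definition _ m n (le_mn : (m <= n)%N) :=
  GRing.isLinear.Build F (M m) (M n) *:%R (minc le_mn) (minc_linear le_mn).

Lemma minc_basis m n (le_mn : (m <= n)%N) (E : strings m) :
  tangle E -> minc le_mn (basis D E) = basis D (pad le_mn E).
Proof.
by move/tangle_exists=> [a <-]; apply: (extlin_basis D (fun a => basis D (pad le_mn (val a)))).
Qed.

Lemma minc1 m n (le_mn : (m <= n)%N) : minc le_mn (1 : M m) = 1.
Proof. by rewrite [LHS]minc_basis ?pad_one //; exact: tangle_one. Qed.

Lemma mincM m n (le_mn : (m <= n)%N) (x y : M m) :
  minc le_mn (x * y) = minc le_mn x * minc le_mn y.
Proof.
elim/basis_ind: x => [a aT||c x x' hx hx']; last 2 first.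
- by rewrite linear0 !mul0r linear0.
- by rewrite mulrDl -scalerAl linearP /= hx hx' linearP /= mulrDl -scalerAl.
elim/basis_ind: y => [b bT||c y y' hy hy']; last 2 first.
- by rewrite linear0 !mulr0 linear0.
- by rewrite mulrDr -scalerAr linearP /= hy hy' linearP /= mulrDr -scalerAr.
rewrite mul_basisE // linearZ_LR /= !minc_basis //; last exact: tangle_stack.
rewrite mul_basisE; [|exact: tangle_pad..].
by have [-> ->] := pad_stack le_mn (proj1 aT) (proj1 bT).
Qed.

Lemma minc_minc l m n (le_lm : (l <= m)%N) (le_mn : (m <= n)%N)
    (le_ln : (l <= n)%N) (x : M l) : minc le_mn (minc le_lm x) = minc le_ln x.
Proof.
elim/basis_ind: x => [a aT||c x y hx hy]; rewrite ?linear0 ?linearP /= ?hx ?hy //.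
by rewrite !minc_basis ?pad_pad //; [exact: proj1 aT|exact: tangle_pad].
Qed.

Lemma minc_refl n (le_nn : (n <= n)%N) (x : M n) : minc le_nn x = x.
Proof.
elim/basis_ind: x => [a aT||c x y hx hy]; rewrite ?linear0 ?linearP /= ?hx ?hy //.
by rewrite minc_basis // pad_refl //; exact: proj1 aT.
Qed.

Lemma mE_linear k : linear (@mE F D k).
Proof.
move=> c x y; rewrite /mE scalerA [c * _]mulrC -scalerA -scalerDr; congr (_ *: _).
rewrite scaler_sumr -big_split; apply: eq_bigr => a _ /=.
by rewrite coef_add coef_scale scalerA -scalerDl mulrDl !mulrA.
Qed.

HB.instance Definition _ k :=
  GRing.isLinear.Build F (M k) (M k.-1) *:%R (@mE F D k) (@mE_linear k).

Lemma mE_basis k (E : strings k) : tangle E ->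
  mE (basis D E) = (D^-1 * D ^+ close_loops E) *: basis D (close_last E).
Proof.
move=> /tangle_exists[a <-]; rewrite /mE -scalerA; congr (_ *: _).
rewrite (bigD1 a) //= coef_basis eqxx mul1r big1 ?addr0 // => b nab.
by rewrite coef_basis (inj_eq val_inj) (negPf nab) mul0r scale0r.
Qed.

Section Adjoint.

Variable sigma : {rmorphism F -> F}.
Hypotheses (sigmaK : involutive sigma) (sigmaD : sigma D = D).

Lemma madjP n c (x y : M n) :
  madj sigma (c *: x + y) = sigma c *: madj sigma x + madj sigma y.
Proof.
rewrite /madj scaler_sumr -big_split; apply: eq_bigr => a _ /=.
by rewrite coef_add coef_scale rmorphD rmorphM scalerDl scalerA.
Qed.

Lemma madj0 n : madj sigma (0 : M n) = 0.
Proof. by rewrite /madj big1 // => a _; rewrite coef_zero rmorph0 scale0r. Qed.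

Lemma madjZ n c (x : M n) : madj sigma (c *: x) = sigma c *: madj sigma x.
Proof. by rewrite -[c *: x]addr0 madjP madj0 addr0. Qed.

Lemma madjB n (x y : M n) : madj sigma (x - y) = madj sigma x - madj sigma y.
Proof. by rewrite -scaleN1r addrC madjP rmorphN rmorph1 scaleN1r addrC. Qed.

Lemma madj_basis n (E : strings n) : tangle E ->
  madj sigma (basis D E) = basis D (reflect_strings E).
Proof.
move=> /tangle_exists[a <-]; rewrite /madj.
rewrite (bigD1 a) //= coef_basis eqxx rmorph1 scale1r big1 ?addr0 // => b nab.
by rewrite coef_basis (inj_eq val_inj) (negPf nab) rmorph0 scale0r.
Qed.

Lemma madj1 n : madj sigma (1 : M n) = 1.
Proof. by rewrite [LHS]madj_basis ?reflect_one //; exact: tangle_one. Qed.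

Lemma madjM n (x y : M n) : madj sigma (x * y) = madj sigma y * madj sigma x.
Proof.
elim/basis_ind: x => [a aT||c x x' hx hx']; last 2 first.
- by rewrite madj0 mul0r mulr0 madj0.
- by rewrite mulrDl -scalerAl !madjP hx hx' mulrDr -scalerAr.
elim/basis_ind: y => [b bT||c y y' hy hy']; last 2 first.
- by rewrite madj0 mul0r mulr0 madj0.
- by rewrite mulrDr -scalerAr !madjP hy hy' mulrDl -scalerAl.
rewrite mul_basisE // madjZ !madj_basis //; last exact: tangle_stack.
rewrite mul_basisE; [|exact: tangle_reflect..].
have [-> ->] := stack_reflect (proj1 aT) (proj1 bT).
by rewrite rmorphXn sigmaD.
Qed.

Lemma madjK n : involutive (@madj F D sigma n).
Proof.
move=> x; elim/basis_ind: x => [a aT||c x y hx hy]; last 2 first.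
- by rewrite !madj0.
- by rewrite !madjP hx hy sigmaK.
by rewrite !madj_basis ?reflectK //; exact: tangle_reflect.
Qed.

Lemma madj_minc m n (le_mn : (m <= n)%N) (x : M m) :
  madj sigma (minc le_mn x) = minc le_mn (madj sigma x).
Proof.
elim/basis_ind: x => [a aT||c x y hx hy]; last 2 first.
- by rewrite linear0 !madj0 linear0.
- by rewrite linearP /= !madjP hx hy linearP.
rewrite madj_basis // !minc_basis // ?madj_basis ?pad_reflect //.
  exact: tangle_pad.
exact: tangle_reflect.
Qed.

Lemma madj_mE k (x : M k.+1) : madj sigma (mE x) = mE (madj sigma x).
Proof.
elim/basis_ind: x => [a aT||c x y hx hy]; last 2 first.
- by rewrite linear0 !madj0 linear0.
- by rewrite linearP /= !madjP hx hy linearP.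
rewrite madj_basis // !mE_basis //; last exact: tangle_reflect.
rewrite madjZ rmorphM fmorphV /= rmorphXn /= sigmaD.
have [-> ->] := close_reflect (proj1 aT).
by rewrite madj_basis //; exact: tangle_close.
Qed.

Lemma madj_p n i : madj sigma (mp i : M n) = mp i.
Proof. by rewrite madj_basis ?reflect_p //; exact: tangle_p. Qed.

End Adjoint.

(** ** Relations *)

Lemma adjacent_points n i : (1 <= i < n)%N ->
  exists2 a : 'I_n, i = a.+1 & exists a' : 'I_n, a' = a.+1 :> nat.
Proof.
case: i => // i /= lt_in; exists (Ordinal (ltnW lt_in)) => //.
by exists (Ordinal lt_in).
Qed.

Section Generators.

Variables (n i : nat).
Hypothesis i_in : (1 <= i < n)%N.

Lemma tangle_li : tangle (l_strings n i).
Proof. by have [a -> [a' a'E]] := adjacent_points i_in; exact: tangle_l a'E. Qed.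

Lemma tangle_ei : tangle (diag n (cap i) (cap i) (vertical_off i)).
Proof. by have [a -> [a' a'E]] := adjacent_points i_in; exact: tangle_e a'E. Qed.

Lemma mr_ml : mr i * ml i = mp i :> M n.
Proof.
rewrite [LHS]mul_basis; [|exact: tangle_reflect tangle_li|exact: tangle_li].
have [a -> [a' a'E]] := adjacent_points i_in.
by have [-> ->] := stack_rl a'E; rewrite scale1r.
Qed.

Lemma ml_mr : ml i * mr i = mp i.+1 :> M n.
Proof.
rewrite [LHS]mul_basis; [|exact: tangle_li|exact: tangle_reflect tangle_li].
have [a -> [a' a'E]] := adjacent_points i_in.
by have [-> ->] := stack_lr a'E; rewrite scale1r a'E.
Qed.

Lemma mp_ml : mp i.+1 * ml i = ml i :> M n.
Proof.
rewrite [LHS]mul_basis; [|exact: tangle_p|exact: tangle_li].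
have [a -> [a' a'E]] := adjacent_points i_in.
by have := stack_pl a'E; rewrite a'E => -[-> ->]; rewrite scale1r.
Qed.

Lemma mp_mr : mp i * mr i = mr i :> M n.
Proof.
rewrite [LHS]mul_basis; [|exact: tangle_p|exact: tangle_reflect tangle_li].
have [a -> [a' a'E]] := adjacent_points i_in.
by have [-> ->] := stack_pr a'E; rewrite scale1r.
Qed.

Lemma mp_me : mp i.+1 * me i = mp i * me i :> M n.
Proof.
rewrite /me -!scalerAr; congr (_ *: _).
rewrite !mul_basisE; try exact: tangle_p; try exact: tangle_ei.
have [a -> [a' a'E]] := adjacent_points i_in.
by have := stack_pe a'E; rewrite a'E => -[-> ->].
Qed.

Lemma madj_ml (sigma : {rmorphism F -> F}) : madj sigma (ml i : M n) = mr i.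
Proof. by rewrite madj_basis //; exact: tangle_li. Qed.

Lemma madj_mr (sigma : {rmorphism F -> F}) : madj sigma (mr i : M n) = ml i.
Proof.
by rewrite madj_basis ?reflectK //; exact: tangle_reflect tangle_li.
Qed.

Lemma madj_me (sigma : {rmorphism F -> F}) : sigma D = D ->
  madj sigma (me i : M n) = me i.
Proof.
move=> sD; rewrite /me madjZ fmorphV /= sD madj_basis ?reflect_e //.
exact: tangle_ei.
Qed.

End Generators.

Lemma mp_mp n i : mp i * mp i = mp i :> M n.
Proof.
rewrite [LHS]mul_basis; [|exact: tangle_p..].
by have [-> ->] := stack_pp n i; rewrite scale1r.
Qed.

Lemma minc_mp m n (le_mn : (m <= n)%N) i : (i <= m)%N ->
  minc le_mn (mp i : M m) = mp i.
Proof. by move=> im; rewrite minc_basis ?pad_p //; exact: tangle_p. Qed.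

Lemma minc_me m n (le_mn : (m <= n)%N) i : (1 <= i < m)%N ->
  minc le_mn (me i : M m) = me i.
Proof.
move=> im; rewrite /me linearZ_LR /= minc_basis ?pad_e //; last exact: tangle_ei.
by case/andP: im.
Qed.

Lemma mp_comm k (x : M k) :
  mp k.+1 * minc (leqnSn k) x = minc (leqnSn k) x * mp k.+1.
Proof.
elim/basis_ind: x => [a aT||c x y hx hy]; last 2 first.
- by rewrite linear0 mulr0 mul0r.
- by rewrite linearP /= mulrDr mulrDl -scalerAr -scalerAl hx hy.
rewrite minc_basis // !mul_basisE; try exact: tangle_p; try exact: tangle_pad.
by have [-> ->] := stack_p_pad (proj1 aT).
Qed.

Lemma mE_mulr_l k (x : M k) (y : M k.+1) :
  mE (minc (leqnSn k) x * y) = x * mE y.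
Proof.
elim/basis_ind: x => [a aT||c x x' hx hx']; last 2 first.
- by rewrite linear0 !mul0r linear0.
- by rewrite linearP /= mulrDl -scalerAl linearP /= hx hx' mulrDl -scalerAl.
elim/basis_ind: y => [b bT||c y y' hy hy']; last 2 first.
- by rewrite linear0 !mulr0 linear0.
- by rewrite mulrDr -scalerAr linearP /= hy hy' linearP /= mulrDr scalerAr.
have apT := tangle_pad (leqnSn k) aT; have bcT := tangle_close bT.
rewrite minc_basis // mul_basisE // linearZ_LR /= !mE_basis //; last exact: tangle_stack.
rewrite -scalerAr mul_basisE // !scalerA.
have [-> kE] := close_pad_stack (proj1 aT) (proj1 bT).
by congr (_ *: _); rewrite mulrCA -!mulrA -!exprD addnC kE addnC.
Qed.

Lemma mE_mulr_r k (x : M k) (y : M k.+1) :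
  mE (y * minc (leqnSn k) x) = mE y * x.
Proof.
have idD : idfun D = D by [].
apply: (can_inj (@madjK idfun (fun _ => erefl) k)).
rewrite madj_mE // madjM // madj_minc mE_mulr_l.
by rewrite [RHS]madjM // -madj_mE.
Qed.

Lemma mE1 k : D != 0 -> mE (1 : M k.+1) = 1.
Proof.
move=> D0; have [cE lE] := close_one k.
rewrite [LHS]mE_basis; last exact: tangle_one.
by rewrite cE lE expr1 mulVf // scale1r.
Qed.

Lemma mE_mp k : mE (mp k.+1 : M k.+1) = D^-1 *: 1.
Proof.
have [cE lE] := close_p k.
rewrite mE_basis; last exact: tangle_p.
by rewrite cE lE mulr1.
Qed.

Lemma mE_me k : mE (me k.+1 : M k.+2) = (D^-1 * D^-1) *: 1.
Proof.
have [cE lE] := close_e k.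
rewrite linearZ_LR /= mE_basis; last by apply: tangle_ei; rewrite /= ltnS leqnn.
by rewrite cE lE mulr1 scalerA.
Qed.

(** Compressing by the last [e_i] realizes the conditional expectation. *)
Lemma me_minc_me k (x : M k.+1) :
  me k.+1 * minc (leqnSn k.+1) x * me k.+1 =
  minc (leqnSn k.+1) (minc (leqnSn k) (mE x)) * me k.+1 :> M k.+2.
Proof.
elim/basis_ind: x => [a aT||c x y hx hy]; last 2 first.
- by rewrite !linear0 mulr0 !mul0r.
- move: (me k.+1 : M k.+2) hx hy => e hx hy.
  rewrite !linearP /= mulrDr -scalerAr mulrDl -scalerAl hx hy.
  by rewrite mulrDl -scalerAl.
set e := diag k.+2 (cap k.+1) (cap k.+1) (vertical_off k.+1).
have eT : tangle e by apply: tangle_ei; rewrite /= ltnS leqnn.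
have aT1 := tangle_pad (leqnSn k.+1) aT; have acT := tangle_close aT.
have acT1 := tangle_pad (leqnSn k) acT; have acT2 := tangle_pad (leqnSn k.+1) acT1.
have eaT := tangle_stack eT aT1.
rewrite mE_basis // !linearZ_LR /= !minc_basis // -/e.
rewrite /me -/e -!(scalerAl, scalerAr).
rewrite (mul_basisE eT aT1) -scalerAl (mul_basisE eaT eT) (mul_basisE acT2 eT).
have [-> kE] := stack_e_pad_e (proj1 aT).
rewrite !scalerA -!mulrA [D ^+ close_loops a * _]mulrCA; congr (_ * (_ * _) *: _).
by rewrite -!exprD addnC kE addnC.
Qed.

End Maps.

(** * The projections *)

Section Projections.

Variables (F : fieldType) (D : F).
Local Notation M := (motzkin_alg D).
Local Notation P k := ((mP F k).[mtau D]).

Lemma mP_rec k (x : F) : (mP F k.+2).[x] = (mP F k.+1).[x] - x * (mP F k).[x].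
Proof. by rewrite /= hornerD hornerN hornerM hornerX. Qed.

Lemma rmorph_mP (sigma : {rmorphism F -> F}) k : sigma D = D -> sigma (P k) = P k.
Proof.
move=> sD; have sT : sigma (mtau D) = mtau D.
  by rewrite /mtau /md fmorphV /= rmorphXn rmorphB rmorph1 sD.
suff [] : sigma (P k) = P k /\ sigma (P k.+1) = P k.+1 by [].
elim: k => [|k [IH1 IH2]]; first by rewrite !hornerE rmorph1.
by split=> //; rewrite mP_rec rmorphB rmorphM sT IH1 IH2.
Qed.

(** The coefficient in the recursion that gives [mg D k.+2]. *)
Definition mcoef k : F := D / md D * (P k / P k.+1).

Lemma mg1 : mg D 1 = 1 - mp 1.
Proof. by []. Qed.

Lemma mgSS k : mg D k.+2 =
  minc (leqnSn k.+1) (mg D k.+1) * (1 - mp k.+2) - mcoef k *: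
    (minc (leqnSn k.+1) (mg D k.+1) * me k.+1 * minc (leqnSn k.+1) (mg D k.+1)).
Proof. by []. Qed.

Hypotheses (D0 : D != 0) (D1 : D != 1).

Lemma md_neq0 : md D != 0.
Proof. by rewrite subr_eq0. Qed.

(** The properties of the pair of [mg D k.+1] and [mg D k] that are carried
    along the recursion. Killing [p_i] stands in for killing [l_i] and [r_i],
    which factor through [p_(i+1)] and [p_i]. *)
Record projection k (g : M k.+1) (g' : M k) : Prop := Projection {
  proj_p : forall i, (1 <= i <= k.+1)%N -> g * mp i = 0;
  proj_e : forall i, (1 <= i < k.+1)%N -> g * me i = 0;
  proj_adj : forall sigma : {rmorphism F -> F}, sigma D = D -> madj sigma g = g;
  proj_idem : g * g = g;
  proj_E : mE g = (md D * P k.+1 / (D * P k)) *: g';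
  proj_absorb : minc (leqnSn k) g' * g = g;
  proj_absorbr : g * minc (leqnSn k) g' = g }.

Lemma projection_1 : projection (mg D 1) (mg D 0).
Proof.
have p1 : mp 1 * mp 1 = mp 1 :> M 1 by exact: mp_mp.
rewrite mg1; split.
- by case=> [|[|i]] // _; rewrite mulrBl mul1r p1 subrr.
- by case=> [|[|i]].
- by move=> sigma sD; rewrite madjB madj1 madj_p.
- by rewrite mulrBl mul1r mulrBr mulr1 p1 subrr subr0.
- rewrite linearB /= mE1 // mE_mp -[X in X - _]scale1r -scalerBl !hornerE.
  by congr (_ *: _); rewrite mulrBl divff // mul1r.
- by rewrite [minc _ _]minc1 mul1r.
by rewrite [minc _ _]minc1 mulr1.
Qed.

Lemma projection_S k (g : M k.+1) (g' : M k) :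
    P k != 0 -> P k.+1 != 0 -> projection g g' ->
  let h := minc (leqnSn k.+1) g in
  projection (h * (1 - mp k.+2) - mcoef k *: (h * me k.+1 * h)) g.
Proof.
move=> Pk0 Pk1 [gp ge gadj gg gE _ gg'] h; set c := mcoef k.
set p : M k.+2 := mp k.+2; set e : M k.+2 := me k.+1.
have idD : (idfun : {rmorphism F -> F}) D = D by [].
have ek : (1 <= k.+1 < k.+2)%N by rewrite /= ltnS leqnn.
have hh : h * h = h by rewrite -mincM gg.
have hadj (sigma : {rmorphism F -> F}) : sigma D = D -> madj sigma h = h.
  by move=> sD; rewrite madj_minc gadj.
have hp i : (1 <= i <= k.+1)%N -> h * mp i = 0.
  by move=> ik; rewrite -(minc_mp D (leqnSn k.+1)) ?(andP ik).2 // -mincM gp // linear0.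
have ph i : (1 <= i <= k.+1)%N -> mp i * h = 0.
  move=> ik; rewrite -[mp i](madj_p _ idfun) -(hadj idfun idD) -madjM //.
  by rewrite hp // madj0.
have he i : (1 <= i < k.+1)%N -> h * me i = 0.
  by move=> ik; rewrite -(minc_me D (leqnSn k.+1)) // -mincM ge // linear0.
have hpC : p * h = h * p by exact: mp_comm.
have pp : p * p = p by exact: mp_mp.
have pe : p * e = mp k.+1 * e by exact: mp_me.
have ep : e * p = e * mp k.+1.
  apply: (can_inj (@madjK _ _ idfun (fun _ => erefl) _)).
  by rewrite !(madjM idD) !madj_p (madj_me ek idD).
have kk : (1 <= k.+1 <= k.+1)%N by rewrite /= leqnn.
(* [p] can be moved through the cap to a projection killed by [h]. *)
have hpe : h * p * e = 0 by rewrite -mulrA pe mulrA hp // mul0r.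
have eph : e * p * h = 0 by rewrite ep -mulrA ph // mulr0.
(* The coefficient is the inverse of the factor in the expectation of [g]. *)
have c0 : c * (md D * P k.+1 / (D * P k)) = 1.
  rewrite /c /mcoef; move: md_neq0 => d0; field; by rewrite D0 d0 Pk0 Pk1.
have hehe : c *: (h * e * h * e) = h * e.
  rewrite -mulrA -mulrA [e * _]mulrA [e * h * e]me_minc_me gE !linearZ_LR /=.
  rewrite -scalerAl -scalerAr scalerA c0 scale1r mulrA -mincM.
  by rewrite gg'.
set G := h * (1 - p) - c *: (h * e * h).
have hC : (1 - p) * h = h * (1 - p) by rewrite mulrBl mul1r hpC mulrBr mulr1.
have Gh : G * h = G.
  by rewrite {1}/G mulrBl -scalerAl -(mulrA h (1 - p)) hC mulrA hh -(mulrA (h * e)) hh.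
have hG : h * G = G by rewrite /G mulrBr -scalerAr !mulrA hh.
have Ge : G * e = 0.
  by rewrite /G mulrBl -scalerAl hehe mulrBr mulr1 mulrBl hpe subr0 subrr.
have Gp : G * p = 0.
  rewrite /G mulrBl -scalerAl -(mulrA h (1 - p)) mulrBl mul1r pp subrr mulr0.
  by rewrite -(mulrA (h * e)) -hpC -(mulrA h e) (mulrA e) eph mulr0 scaler0 subr0.
split.
- move=> i /andP[i1]; rewrite leq_eqVlt => /orP[/eqP->//|ik].
  by rewrite -Gh -mulrA hp ?mulr0 // i1.
- move=> i /andP[i1]; rewrite ltnS leq_eqVlt => /orP[/eqP->//|ik].
  by rewrite -Gh -mulrA he ?mulr0 // i1.
- move=> sigma sD; have hs := hadj sigma sD.
  have ps : madj sigma p = p by exact: madj_p.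
  have es : madj sigma e = e by exact: madj_me.
  have cs : sigma c = c.
    by rewrite /c /mcoef !rmorphM !fmorphV !rmorph_mP // /md rmorphB rmorph1 sD.
  rewrite madjB madjZ (madjM sD h) madjB madj1 ps hs hC.
  by rewrite (madjM sD (h * e)) (madjM sD h) es hs cs mulrA.
- transitivity (G * (h * (1 - p) - c *: (h * e * h))); first by [].
  rewrite mulrBr -scalerAr !mulrA Gh Ge mul0r scaler0 subr0.
  by rewrite mulrBr mulr1 Gp subr0.
- have E1 : mE (h * (1 - p)) = g * mE (1 - p) by exact: mE_mulr_l.
  have E2 : mE (h * e * h) = g * mE e * g.
    by rewrite [LHS]mE_mulr_r [mE (h * e)]mE_mulr_l.
  have -> : mE G = g * mE (1 - p) - c *: (g * mE e * g).
    transitivity (mE (h * (1 - p)) - mE (c *: (h * e * h))); first exact: linearB.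
    by rewrite -E1 -E2; congr (_ - _); exact: linearZ_LR.
  have -> : mE (1 - p) = 1 - D^-1 *: 1 by rewrite linearB /= mE1 // mE_mp.
  rewrite mE_me.
  rewrite mulrBr mulr1 -!scalerAr !mulr1 -scalerAl gg scalerA.
  rewrite -[X in X - _ - _]scale1r -!scalerBl.
  congr (_ *: _); rewrite mP_rec /c /mcoef /mtau.
  by move: md_neq0 Pk1 => d0; rewrite /mtau /md in d0 * => Pk1; field; rewrite D0 d0 Pk1.
- exact: hG.
exact: Gh.
Qed.

Variable n : nat.
Hypothesis D_generic : generic D n.

Lemma generic_neq0 k : (k <= n)%N -> P k != 0.
Proof.
case: k => [|k] kn; first by rewrite hornerC oner_eq0.
by apply: D_generic; rewrite kn.
Qed.

Lemma mg_projection k : (k < n)%N -> projection (mg D k.+1) (mg D k).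
Proof.
elim: k => [|k IHk] kn; first exact: projection_1.
rewrite mgSS; apply: projection_S (IHk (ltnW kn)); apply: generic_neq0; lia.
Qed.

Lemma minc_mg_mg i j (le_ij : (i <= j)%N) : (j <= n)%N ->
  minc le_ij (mg D i) * mg D j = mg D j.
Proof.
elim: j le_ij => [|j IHj] le_ij jn.
  case: i le_ij => // le_ij.
  by rewrite minc_refl mul1r.
have gj := mg_projection jn.
have := le_ij; rewrite leq_eqVlt => /orP[/eqP ijE|]; last first.
  rewrite ltnS => le_ij'; rewrite -(minc_minc le_ij' (leqnSn j)).
  by rewrite -[in LHS](proj_absorb gj) mulrA -mincM IHj ?proj_absorb // ltnW.
by subst i; rewrite minc_refl (proj_idem gj).
Qed.

Lemma mg_left_zero k (x y : M k.+1) : (k < n)%N ->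
  madj idfun x = y -> mg D k.+1 * y = 0 -> x * mg D k.+1 = 0.
Proof.
move=> kn xy gy; apply: (can_inj (@madjK F D idfun (fun _ => erefl) _)).
rewrite (@madjM F D idfun erefl) madj0 xy.
by rewrite (proj_adj (mg_projection kn) (sigma := idfun)).
Qed.

Lemma mg_kills k i : (k < n)%N -> (1 <= i < k.+1)%N ->
  [/\ mg D k.+1 * ml i = 0, mg D k.+1 * mr i = 0 & mg D k.+1 * me i = 0] /\
  [/\ ml i * mg D k.+1 = 0, mr i * mg D k.+1 = 0 & me i * mg D k.+1 = 0].
Proof.
move=> kn ik; have [gp ge _ _ _ _ _] := mg_projection kn.
case/andP: (ik) => i1 ik'.
have gl : mg D k.+1 * ml i = 0.
  by rewrite -(mp_ml D ik) mulrA gp ?mul0r // ik'.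
have gr : mg D k.+1 * mr i = 0.
  by rewrite -(mp_mr D ik) mulrA gp ?mul0r // i1 ltnW.
have gei : mg D k.+1 * me i = 0 by exact: ge.
do !split=> //.
- exact: mg_left_zero kn (madj_ml D ik idfun) gr.
- exact: mg_left_zero kn (madj_mr D ik idfun) gl.
by apply: mg_left_zero kn _ gei; exact: madj_me.
Qed.

End Projections.

(** * Words *)

Section Words.

Variables (F : fieldType) (D : F).
Local Notation M := (motzkin_alg D).

Lemma basis_inj n (E E' : strings n) : tangle E -> basis D E = basis D E' -> E = E'.
Proof.
move=> /tangle_exists[a <-] /(congr1 (fun x : M n => coef x a)).
rewrite !coef_basis eqxx; case: eqP => // _ /eqP.
by rewrite oner_eq0.
Qed.

Lemma mem_p n i (a : 'I_n) :
  ((inl a, inr a) \in diag n nostring nostring (fun s t => (s == t) && (s != i))) =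
  (a.+1 != i).
Proof. by rewrite inE eqxx. Qed.

Lemma mp_neq1 n i : (1 <= i <= n)%N -> mp i != 1 :> M n.
Proof.
case: i => // i /= lt_in; apply/eqP => /(basis_inj (tangle_p n i.+1)).
move/setP/(_ (inl (Ordinal lt_in), inr (Ordinal lt_in))).
by rewrite mem_p inE !eqxx.
Qed.

Lemma mp_neq n i j : (1 <= i <= n)%N -> i != j -> mp i != mp j :> M n.
Proof.
case: i => // i /= lt_in nij; apply/eqP => /(basis_inj (tangle_p n i.+1)).
move/setP/(_ (inl (Ordinal lt_in), inr (Ordinal lt_in))).
by rewrite !mem_p eqxx nij.
Qed.

(** A letter does not have a right inverse. *)
Lemma letter_mul_neq1 k (x y : M k) : is_letter x -> x * y != 1.
Proof.
case=> j jk xE; have jk' : (1 <= j < k)%N by case: k {x y xE} jk => [|k]; lia.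
have jk1 : (1 <= j.+1 <= k)%N by case/andP: jk'.
have jk0 : (1 <= j <= k)%N by lia.
apply/eqP=> xy; case: xE => xE.
- have := mp_neq1 jk1; rewrite -[mp _]mulr1 -xy mulrA xE mp_ml // -xE xy.
  by rewrite eqxx.
- have := mp_neq1 jk0; rewrite -[mp _]mulr1 -xy mulrA xE mp_mr // -xE xy.
  by rewrite eqxx.
have := @mp_neq k j.+1 j jk1; rewrite -[mp j.+1]mulr1 -[mp j]mulr1 -xy !mulrA xE.
by rewrite mp_me // eqxx => /(_ (negbT (gtn_eqF (ltnSn j)))).
Qed.

(** The span of the non-empty words. *)
Inductive word_span k : M k -> Prop :=
| WordSpan0 : word_span 0
| WordSpanS c (s : seq (M k)) x : s <> [::] ->
    (forall y, y \in s -> is_letter y) -> word_span x ->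
    word_span (c *: foldr *%R 1 s + x).

Section Closure.

Variable k : nat.
Implicit Types x y : M k.

Lemma word_span_letter x : is_letter x -> word_span x.
Proof.
move=> xl; rewrite -[x]mulr1 -[x * 1]scale1r -[1 *: _]addr0.
apply: (@WordSpanS _ 1 [:: x]) => //; last exact: WordSpan0.
by move=> y; rewrite inE => /eqP->.
Qed.

Lemma word_spanD x y : word_span x -> word_span y -> word_span (x + y).
Proof.
move=> xs ys; elim: xs => [|c s z s0 sl _ IH]; first by rewrite add0r.
by rewrite -addrA; apply: WordSpanS.
Qed.

Lemma word_spanZ c x : word_span x -> word_span (c *: x).
Proof.
elim=> [|c' s z s0 sl _ IH]; first by rewrite scaler0; exact: WordSpan0.
by rewrite scalerDr scalerA; apply: WordSpanS.
Qed.

Lemma word_spanN x : word_span x -> word_span (- x).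
Proof. by rewrite -scaleN1r; apply: word_spanZ. Qed.

Lemma word_spanM x y : word_span x -> word_span y -> word_span (x * y).
Proof.
move=> xs ys; elim: xs => [|c s z s0 sl _ IH]; first by rewrite mul0r; exact: WordSpan0.
rewrite mulrDl; apply: word_spanD IH; rewrite -scalerAl; apply: word_spanZ.
elim: ys => [|c' s' z' s0' sl' _ IH']; first by rewrite mulr0; exact: WordSpan0.
rewrite mulrDr; apply: word_spanD IH'; rewrite -scalerAr.
have -> : foldr *%R 1 s * foldr *%R 1 s' = foldr *%R 1 (s ++ s').
  by elim: s {s0 sl} => [|t s IHs] /=; rewrite ?mul1r // -mulrA IHs.
rewrite -[_ *: _]addr0; apply: WordSpanS; last exact: WordSpan0.
  by case: (s) s0.
by move=> t; rewrite mem_cat => /orP[/sl|/sl'].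
Qed.

(** Multiplying by an element of [1] plus the span. *)
Lemma word_span_unipotent_l x y : word_span (x - 1) -> word_span y -> word_span (x * y).
Proof.
move=> xs ys; rewrite -[x](subrK 1) mulrDl mul1r.
exact: word_spanD (word_spanM xs ys) ys.
Qed.

Lemma word_span_unipotent_r x y : word_span (x - 1) -> word_span y -> word_span (y * x).
Proof.
move=> xs ys; rewrite -[x](subrK 1) mulrDr mulr1.
exact: word_spanD (word_spanM ys xs) ys.
Qed.

Lemma word_span_sum x : word_span x ->
  exists (m : nat) (c : 'I_m -> F) (w : 'I_m -> M k),
    (forall i, is_word (w i) /\ w i != mone) /\ x = \sum_(i < m) c i *: w i.
Proof.
elim=> [|c s y s0 sl _ [m [c' [w [wE ->]]]]].
  exists 0%N, (fun=> 0), (fun=> 0); split; last by rewrite big_ord0.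
  by case.
exists m.+1, (fun i => oapp c' c (unlift ord0 i)),
  (fun i => oapp w (foldr *%R 1 s) (unlift ord0 i)); split.
  move=> i; case: (unliftP ord0 i) => [j _|_] /=; first exact: wE.
  split; first by exists s.
  by case: s s0 sl => // t s _ /(_ t (mem_head _ _)) tl; exact: letter_mul_neq1 tl.
rewrite big_ord_recl unlift_none /=; congr (_ + _).
by apply: eq_bigr => i _; rewrite liftK.
Qed.

End Closure.

(** This includes the first projection [1 - p_1], because [p_1 = r_1 l_1] once
    there are two strings. *)
Lemma minc_mg_word_span k m (le_km : (k.+1 <= m)%N) : (2 <= m)%N ->
  word_span (minc le_km (mg D k.+1) - 1).
Proof.
elim: k m le_km => [|k IHk] m le_km m2.
  rewrite mg1 linearB /= minc1 minc_mp // addrC addKr; apply: word_spanN.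
  rewrite -mr_ml //; apply: word_spanM; apply: word_span_letter; exists 1%N;
    by [case: m m2 {le_km} => [|[|m]]|auto; constructor].
have le_km' : (k.+1 <= m)%N by exact: ltnW.
have km : (1 <= k.+1 < m)%N by [].
have km' : (1 <= k.+1 <= m.-1)%N by lia.
have xs := IHk m le_km' m2; set x := minc le_km' _ in xs.
have -> : minc le_km (mg D k.+2) =
    x * (1 - mp k.+2) - mcoef D k *: (x * me k.+1 * x).
  rewrite mgSS linearB linearZ_LR /= !mincM linearB /= minc1 minc_mp // minc_me //.
    by rewrite !(minc_minc _ _ le_km').
  by rewrite /= ltnS leqnn.
have es : word_span (me k.+1 : M m).
  by apply: word_span_letter; exists k.+1 => //; constructor 3.
have ps : word_span (mp k.+2 : M m).
  rewrite -(ml_mr D km); apply: word_spanM; apply: word_span_letter; exists k.+1 => //.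
    by constructor 1.
  by constructor 2.
rewrite mulrBr mulr1 addrAC [x - _ - 1]addrAC.
apply: word_spanD; first apply: word_spanD => //; apply: word_spanN.
  exact: word_span_unipotent_l.
apply: word_spanZ; apply: word_span_unipotent_r => //.
exact: word_span_unipotent_l.
Qed.

End Words.

Theorem proposition2p4 (F : fieldType) (D : F)
    (sigma : {rmorphism F -> F}) (n : nat)
    (sigmaK : involutive sigma) (sigmaD : sigma D = D)
    (D_neq0 : D != 0) (D_neq1 : D != 1)
    (n_ge2 : (2 <= n)%N) (D_generic : generic D n) :
  forall k : nat, (2 <= k <= n)%N ->
  [/\ forall i : nat, (1 <= i <= k.-1)%N ->
        [/\ mg D k ** ml i = 0, mg D k ** mr i = 0 & mg D k ** me i = 0] /\
        [/\ ml i ** mg D k = 0, mr i ** mg D k = 0 & me i ** mg D k = 0],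
      mg D k = madj sigma (mg D k) /\ mg D k = mg D k ** mg D k,
      mE (mg D k) =
        (md D * (mP F k).[mtau D] / (D * (mP F k.-1).[mtau D])) *: mg D k.-1,
      forall (i j : nat) (le_ij : (i <= j)%N), (1 <= i)%N -> (j <= n)%N ->
        minc le_ij (mg D i) ** mg D j = mg D j
    & exists (m : nat) (c : 'I_m -> F) (w : 'I_m -> motzkin_alg D k),
        (forall i : 'I_m, is_word (w i) /\ w i != mone) /\
        mg D k = mone + \sum_(i < m) c i *: w i].
Proof.
move=> [//|k] /andP[k1 kn].
have gk := mg_projection D_neq0 D_neq1 D_generic kn.
split.
- by move=> i ik; apply: mg_kills D_generic _ _ kn _; rewrite // ltnS.
- by split; rewrite ?(proj_adj gk) //; rewrite [RHS](proj_idem gk).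
- exact: proj_E gk.
- by move=> i j le_ij _ jn; apply: (minc_mg_mg D_neq0 D_neq1 D_generic).
have /word_span_sum[m [c [w [wP wE]]]] := minc_mg_word_span D (leqnn k.+1) k1.
by exists m, c, w; split=> //; rewrite -wE minc_refl addrC subrK.
Qed.
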